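(* Let $(M,\omega)$ be a compact Kähler manifold and, for $j=1,\dots,m$, let $E_j\to M$ be a very ample holomorphic vector bundle over $M$ with $\operatorname{rank}E_j=r_j$ and $\dim H^0(M,E_j)=N_j>0$. Suppose that each $E_j$ admits an $\omega$-balanced metric. Then the vector bundle $E=\bigoplus_{j=1}^m E_j\to M$ admits a unique $\omega$-balanced metric if and only if $\frac{r_j}{N_j}=\frac{r_k}{N_k}$ for all $j,k=1,\dots,m$.
   Context: $H^0(M,E)$ is the space of global holomorphic sections of $E$. Let $E\to M$ be a very ample holomorphic vector bundle of rank $r$ over a compact Kähler manifold $(M,\omega)$ of complex dimension $n$, with $\dim H^0(M,E)=N$. Let $G(r,N)$ be the Grassmannian of $r$-dimensional subspaces of $\mathbb{C}^N$, $\mathcal{T}\to G(r,N)$ the tautological bundle, and $\mathcal{Q}=\mathcal{T}^*$ the quotient bundle. For a basis $\underline{s}=(s_1,\dots,s_N)$ of $H^0(M,E)$, the Kodaira map $i_{\underline{s}}:M\to G(r,N)$ sends $x$ to the image of the injective linear map $E_x^*\to\mathbb{C}^N$, $\xi\mapsto(\xi(s_1(x)),\dots,\xi(s_N(x)))$. One writes $E=i_{\underline{s}}^*\mathcal{Q}$, with $s_j$ the pull-back of the section of $\mathcal{Q}$ defined by the $j$-th coordinate function on $\mathbb{C}^N$. Very ample means that $E$ is generated by its global sections and $i_{\underline{s}}$ is an embedding. Let $h_0(v,w)=w^*v$ be the flat hermitian metric on $\mathcal{T}$ induced from $\mathbb{C}^N$, and $h_{Gr}=h_0^*$ the dual metric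 on $\mathcal{Q}$. Put $h_{\underline{s}}=i_{\underline{s}}^*h_{Gr}$, a hermitian metric on $E=i_{\underline{s}}^*\mathcal{Q}$, and $$\langle\cdot,\cdot\rangle_{h_{\underline{s}}}=\frac{1}{V(M)}\int_M h_{\underline{s}}(\cdot,\cdot)\frac{\omega^n}{n!},\qquad V(M)=\int_M\frac{\omega^n}{n!},$$ an $L^2$-product on $H^0(M,E)$. A hermitian metric $h$ on $E$ is called $\omega$-balanced if there is a basis $\underline{s}$ of $H^0(M,E)$ such that $h=h_{\underline{s}}=i_{\underline{s}}^*h_{Gr}$ and $\langle s_j,s_k\rangle_{h_{\underline{s}}}=\frac{r}{N}\delta_{jk}$ for all $j,k=1,\dots,N$.
   Formalization: ''Unique'' is read as unique up to holomorphic automorphisms of E covering the identity; literal uniqueness of the metric always fails, since rescaling a balanced basis s to cs gives the balanced metric |c|^{-2}h. *)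

(* Defs.v *)
(* MathComp-Analysis, over an arbitrary R : realType; C is R[i].              *)
From HB Require Import structures.
From mathcomp Require Import all_boot all_order all_algebra all_fingroup.
From mathcomp Require Import all_classical all_reals all_analysis.
From mathcomp Require Import complex.

Set Implicit Arguments.
Unset Strict Implicit.
Unset Printing Implicit Defensive.

Import Order.TTheory GRing.Theory Num.Theory.
Import numFieldNormedType.Exports.

Local Open Scope classical_set_scope.
Local Open Scope ring_scope.

(* C^n is modelled on R^(n + n): the row (x, y) stands for z = x + i y.       *)
Section ComplexCalculus.
Context {R : realType} {n : nat}.
Local Notation Cn := ('rV[R]_(n + n)).

Definition cstruct (v : Cn) : Cn := row_mx (- rsubmx v) (lsubmx v).

Definition ccoord (k : 'I_n) (v : Cn) : R[i] :=
  Complex (v 0 (lshift n k)) (v 0 (rshift n k)).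

Fixpoint differentiability_class (k : nat) (U : set Cn) (f : Cn -> R) : Prop :=
  (forall p, U p -> {for p, continuous f}) /\
  match k with
  | 0 => True
  | k'.+1 => forall v : Cn,
      (forall p, U p -> derivable f p v) /\
      differentiability_class k' U (fun p => 'D_v f p)
  end.

Definition smooth (U : set Cn) (f : Cn -> R) : Prop :=
  forall k, differentiability_class k U f.

Definition csmooth (U : set Cn) (f : Cn -> R[i]) : Prop :=
  smooth U (fun p => complex.Re (f p)) /\ smooth U (fun p => complex.Im (f p)).

Definition cderive (f : Cn -> R[i]) (p v : Cn) : R[i] :=
  Complex ('D_v (fun q => complex.Re (f q)) p)
          ('D_v (fun q => complex.Im (f q)) p).

(* The second clause is the system of Cauchy-Riemann equations, dbar f = 0.   *)
Definition holomorphic (U : set Cn) (f : Cn -> R[i]) : Prop :=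
  csmooth U f /\
  forall p v, U p -> cderive f p (cstruct v) = 'i * cderive f p v.

End ComplexCalculus.

(* Second countability is automatic for a compact manifold. Points are needed *)
(* to equip the carrier with its Borel sigma-algebra.                         *)
Record compact_complex_manifold (R : realType) (n : nat) := {
  carrier :> ptopologicalType;
  carrier_hausdorff : hausdorff_space carrier;
  carrier_compact : compact [set: carrier];
  chart_index : Type;
  chart_dom : chart_index -> set carrier;
  chart : chart_index -> carrier -> 'rV[R]_(n + n);
  chart_inv : chart_index -> 'rV[R]_(n + n) -> carrier;
  chart_dom_open : forall c, open (chart_dom c);
  chart_cover : forall x, exists c, chart_dom c x;
  chart_image_open : forall c, open (chart c @` chart_dom c);
  chartK : forall c x, chart_dom c x -> chart_inv c (chart c x) = x;
  chart_continuous : forall c x, chart_dom c x -> {for x, continuous (chart c)};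
  chart_inv_continuous : forall c p, (chart c @` chart_dom c) p ->
    {for p, continuous (chart_inv c)};
  chart_transition : forall c d k,
    holomorphic (chart c @` (chart_dom c `&` chart_dom d))
      (fun p => ccoord k (chart d (chart_inv c p)))
}.

Section FunctionsOnManifold.
Context {R : realType} {n : nat} {M : compact_complex_manifold R n}.

Definition csmooth_on (W : set M) (f : M -> R[i]) : Prop :=
  forall c : chart_index M,
    csmooth (chart c @` (chart_dom c `&` W)) (fun p => f (chart_inv c p)).

Definition holomorphic_on (W : set M) (f : M -> R[i]) : Prop :=
  forall c : chart_index M,
    holomorphic (chart c @` (chart_dom c `&` W)) (fun p => f (chart_inv c p)).

End FunctionsOnManifold.

(* A Kaehler form through its expressions in the charts: kform c p u v is     *)
(* omega_p (u, v) in the chart c. kform_closed is d omega = 0 evaluated on    *)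
(* constant vector fields.                                                    *)
Record kaehler_form (R : realType) (n : nat)
    (M : compact_complex_manifold R n) := {
  kform :> chart_index M ->
    'rV[R]_(n + n) -> 'rV[R]_(n + n) -> 'rV[R]_(n + n) -> R;
  kform_linear : forall c p, (chart c @` chart_dom c) p -> forall a u u' v,
    kform c p (a *: u + u') v = a * kform c p u v + kform c p u' v;
  kform_alternating : forall c p, (chart c @` chart_dom c) p -> forall u v,
    kform c p u v = - kform c p v u;
  kform_smooth : forall c u v,
    smooth (chart c @` chart_dom c) (fun p => kform c p u v);
  kform_transition : forall c d x, chart_dom c x -> chart_dom d x ->
    forall u v,
    let dtau w := 'D_w (fun p => chart d (chart_inv c p)) (chart c x) in
    kform d (chart d x) (dtau u) (dtau v) = kform c (chart c x) u v;
  kform_type11 : forall c p, (chart c @` chart_dom c) p -> forall u v,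
    kform c p (cstruct u) (cstruct v) = kform c p u v;
  kform_positive : forall c p, (chart c @` chart_dom c) p -> forall u,
    u != 0 -> 0 < kform c p u (cstruct u);
  kform_closed : forall c p, (chart c @` chart_dom c) p -> forall u v w,
    'D_u (fun q => kform c q v w) p + 'D_v (fun q => kform c q w u) p
      + 'D_w (fun q => kform c q u v) p = 0
}.

Definition borel {R : realType} {n : nat} (M : compact_complex_manifold R n) :=
  g_sigma_algebraType (@open M).

Section Volume.
Context {R : realType} {n : nat} {M : compact_complex_manifold R n}.

(* By Tonelli, the Lebesgue integral on R^k for nonnegative Borel functions.  *)
Fixpoint lebesgue_iterated (k : nat) : ('rV[R]_k -> \bar R) -> \bar R :=
  match k return ('rV[R]_k -> \bar R) -> \bar R with
  | 0 => fun f => f 0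
  | k'.+1 => fun f =>
      (\int[@lebesgue_measure R]_(x in setT)
         lebesgue_iterated (fun v : 'rV[R]_k' => f (row_mx (x%:M : 'rV_1) v)))%E
  end.

(* The positively oriented frame e_1, i e_1, e_2, i e_2, etc. of C^n, which   *)
(* is dual to dx_1, dy_1, dx_2, dy_2, etc.                                    *)
Definition oriented_frame (k : 'I_(2 * n)) : 'rV[R]_(n + n) :=
  \row_(l < n + n) ((l : nat) == (if odd k then n + k./2 else k./2)%N)%:R.

Lemma pair_fst_subproof (i : 'I_n) : (2 * i < 2 * n)%N.
Proof. by rewrite ltn_mul2l /=. Qed.

Lemma pair_snd_subproof (i : 'I_n) : ((2 * i).+1 < 2 * n)%N.
Proof.
by rewrite (leq_trans (_ : _ < 2 * i.+1)%N) ?leq_mul2l //= mulnS !addSn.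
Qed.

Definition pair_fst (i : 'I_n) : 'I_(2 * n) := Ordinal (pair_fst_subproof i).
Definition pair_snd (i : 'I_n) : 'I_(2 * n) := Ordinal (pair_snd_subproof i).

(* The exterior power omega^n = omega /\ ... /\ omega on 2n vectors.          *)
Definition wedge_power (w : 'rV[R]_(n + n) -> 'rV[R]_(n + n) -> R)
    (v : 'I_(2 * n) -> 'rV[R]_(n + n)) : R :=
  (2 ^+ n)^-1 * \sum_(s : 'S_(2 * n)) (-1) ^+ s *
    \prod_(i < n) w (v (s (pair_fst i))) (v (s (pair_snd i))).

(* omega^n / n! = volume_density dx_1 /\ dy_1 /\ ... /\ dx_n /\ dy_n.         *)
Definition volume_density (omega : kaehler_form M) (c : chart_index M)
    (p : 'rV[R]_(n + n)) : R :=
  wedge_power (omega c p) oriented_frame / n`!%:R.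

(* mu is the Borel measure A |-> int_A omega^n / n! .                         *)
Definition is_volume (omega : kaehler_form M)
    (mu : {measure set (borel M) -> \bar R}) : Prop :=
  forall (c : chart_index M) (A : set (borel M)),
    measurable A -> A `<=` chart_dom c ->
    mu A = lebesgue_iterated
      (fun p => (\1_(chart c @` A) p * volume_density omega c p)%:E).

End Volume.

Record holomorphic_bundle (R : realType) (n : nat)
    (M : compact_complex_manifold R n) (r : nat) := {
  fiber :> M -> lmodType R[i];
  triv_index : Type;
  triv_dom : triv_index -> set M;
  triv : triv_index -> forall x : M, {linear fiber x -> 'cV[R[i]]_r};
  triv_dom_open : forall a, open (triv_dom a);
  triv_cover : forall x, exists a, triv_dom a x;
  triv_bij : forall a x, triv_dom a x -> bijective (triv a x);
  triv_transition : forall a b, exists g : M -> 'M[R[i]]_r,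
    (forall x, triv_dom a x -> triv_dom b x ->
       forall v, triv b x v = g x *m triv a x v) /\
    (forall i j, holomorphic_on (triv_dom a `&` triv_dom b)
                   (fun x => g x i j))
}.

Section DependentProduct.
Variables (K : pzRingType) (I : Type) (V : I -> lmodType K).

Definition dprod : Type := forall i, V i.

HB.instance Definition _ := gen_eqMixin dprod.
HB.instance Definition _ := gen_choiceMixin dprod.

Definition dprod_zero : dprod := fun=> 0.
Definition dprod_opp (u : dprod) : dprod := fun i => - u i.
Definition dprod_add (u v : dprod) : dprod := fun i => u i + v i.
Definition dprod_scale (a : K) (u : dprod) : dprod := fun i => a *: u i.

Lemma dprod_addA : associative dprod_add.
Proof. by move=> u v w; apply: functional_extensionality_dep => i; exact: addrA. Qed.
Lemma dprod_addC : commutative dprod_add.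
Proof. by move=> u v; apply: functional_extensionality_dep => i; exact: addrC. Qed.
Lemma dprod_add0 : left_id dprod_zero dprod_add.
Proof. by move=> u; apply: functional_extensionality_dep => i; exact: add0r. Qed.
Lemma dprod_addN : left_inverse dprod_zero dprod_opp dprod_add.
Proof. by move=> u; apply: functional_extensionality_dep => i; exact: addNr. Qed.

HB.instance Definition _ := GRing.isZmodule.Build dprod
  dprod_addA dprod_addC dprod_add0 dprod_addN.

Lemma dprod_scaleA a b u : dprod_scale a (dprod_scale b u) = dprod_scale (a * b) u.
Proof. by apply: functional_extensionality_dep => i; exact: scalerA. Qed.
Lemma dprod_scale1 : left_id 1 dprod_scale.
Proof. by move=> u; apply: functional_extensionality_dep => i; exact: scale1r. Qed.
Lemma dprod_scaleDr : right_distributive dprod_scale +%R.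
Proof. by move=> a u v; apply: functional_extensionality_dep => i; exact: scalerDr. Qed.
Lemma dprod_scaleDl u : {morph dprod_scale^~ u : a b / a + b}.
Proof. by move=> a b; apply: functional_extensionality_dep => i; exact: scalerDl. Qed.

HB.instance Definition _ := GRing.Zmodule_isLmodule.Build K dprod
  dprod_scaleA dprod_scale1 dprod_scaleDr dprod_scaleDl.

End DependentProduct.

Section HolomorphicFacts.
Context {R : realType} {n : nat} {M : compact_complex_manifold R n}.

Lemma differentiability_class_sub k (U V : set 'rV[R]_(n + n)) f :
  U `<=` V -> differentiability_class k V f -> differentiability_class k U f.
Proof.
move=> UV; elim: k f => [|k IH] f /= [cf H]; split => //.
- by move=> p /UV; exact: cf.
- by move=> p /UV; exact: cf.
- move=> v; have [df Df] := H v; split; first by move=> p /UV; exact: df.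
  exact: IH.
Qed.

Lemma holomorphic_sub (U V : set 'rV[R]_(n + n)) f :
  U `<=` V -> holomorphic V f -> holomorphic U f.
Proof.
move=> UV [[sR sI] CR]; split; last by move=> p v /UV; exact: CR.
by split => k; apply: (differentiability_class_sub UV); [exact: sR|exact: sI].
Qed.

Lemma holomorphic_on_sub (U V : set M) f :
  U `<=` V -> holomorphic_on V f -> holomorphic_on U f.
Proof.
move=> UV hf c; apply: holomorphic_sub (hf c).
by apply: image_subset => x [cx /UV].
Qed.

Lemma smooth_cst (U : set 'rV[R]_(n + n)) (a : R) : smooth U (fun=> a).
Proof.
move=> k; elim: k a => [|k IH] a /=; split=> //; try by move=> p _; exact: cst_continuous.
move=> v; split; first by move=> p _; exact: derivable_cst.
by have -> : (fun p => 'D_v (fun=> a) p) = (fun=> 0 : R)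
  by [apply/funext => p; exact: derive_cst | exact: IH].
Qed.

Lemma holomorphic_on0 (U : set M) : holomorphic_on U (fun=> 0).
Proof.
move=> c; split; first by split; exact: smooth_cst.
move=> p v _; rewrite /cderive.
have dE w a : 'D_w (fun=> a : R) p = 0 by exact: derive_cst.
by rewrite !dE mulr0.
Qed.

End HolomorphicFacts.

Section DirectSum.
Context {R : realType} {n : nat} {M : compact_complex_manifold R n}.
Context {m : nat} {r : 'I_m -> nat} (E : forall j, holomorphic_bundle M (r j)).

Definition dsum_fiber (x : M) : lmodType R[i] := dprod (fun j => E j x).
Definition dsum_triv_index : Type := forall j, triv_index (E j).
Definition dsum_triv_dom (a : dsum_triv_index) : set M :=
  [set x | forall j, triv_dom (a j) x].
Definition dsum_triv_fun (a : dsum_triv_index) (x : M) (v : dsum_fiber x) :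
    'cV[R[i]]_(\sum_j r j) :=
  \mxcol_j triv (a j) x (v j).

Lemma dsum_triv_linear a x : linear (@dsum_triv_fun a x).
Proof.
move=> k u v; apply/matrixP => s t; rewrite !mxE.
by rewrite (linearP (triv (a _) x) k (u _) (v _)) !mxE.
Qed.

HB.instance Definition _ a x := GRing.isLinear.Build R[i] (dsum_fiber x)
  'cV[R[i]]_(\sum_j r j) *:%R (@dsum_triv_fun a x) (@dsum_triv_linear a x).

Definition dsum_triv (a : dsum_triv_index) (x : M) :
    {linear dsum_fiber x -> 'cV[R[i]]_(\sum_j r j)} := @dsum_triv_fun a x.

Lemma dsum_triv_dom_open a : open (dsum_triv_dom a).
Proof.
rewrite openE => x ax; apply: filter_forall => j.
by apply: open_nbhs_nbhs; split; [exact: triv_dom_open | exact: ax].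
Qed.

Lemma dsum_triv_cover x : exists a, dsum_triv_dom a x.
Proof.
exists (fun j => sval (cid (triv_cover (E j) x))) => j /=.
exact: (svalP (cid (triv_cover (E j) x))).
Qed.

Lemma dsum_triv_bij a x : dsum_triv_dom a x -> bijective (dsum_triv a x).
Proof.
move=> ax; have tb j := triv_bij (ax j).
have ex j : exists g, cancel (triv (a j) x) g /\ cancel g (triv (a j) x).
  by case: (tb j) => g gK Kg; exists g.
pose g j := sval (cid (ex j)).
have gK j : cancel (triv (a j) x) (g j) := (svalP (cid (ex j))).1.
have Kg j : cancel (g j) (triv (a j) x) := (svalP (cid (ex j))).2.
exists (fun w => (fun j => g j (submxcol w j)) : dsum_fiber x) => [v|w].
  by apply: functional_extensionality_dep => j; rewrite mxcolK gK.
by apply/mxcolP => j; rewrite mxcolK Kg.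
Qed.

Lemma mxdiag_entry (s t : 'I_(\sum_j r j)) :
  (exists i u v, forall B : forall j, 'M[R[i]]_(r j), (\mxdiag_j B j) s t = B i u v) \/
  (forall B : forall j, 'M[R[i]]_(r j), (\mxdiag_j B j) s t = 0).
Proof.
have [e|ne] := eqVneq (tagnat.sig1 s) (tagnat.sig1 t); last first.
  by right => B; rewrite !mxE (negbTE ne) mxE.
left; exists (tagnat.sig1 s), (tagnat.sig2 s), (cast_ord (congr1 r (esym e)) (tagnat.sig2 t)) => B.
rewrite !mxE; move: (tagnat.sig2 s) (tagnat.sig2 t); case: _ / e => u v.
by rewrite eqxx conform_mx_id; congr (B _ _ _); exact: val_inj.
Qed.

Lemma dsum_triv_transition a b : exists g : M -> 'M[R[i]]_(\sum_j r j),
  (forall x, dsum_triv_dom a x -> dsum_triv_dom b x ->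
     forall v, dsum_triv b x v = g x *m dsum_triv a x v) /\
  (forall i j, holomorphic_on (dsum_triv_dom a `&` dsum_triv_dom b)
                 (fun x => g x i j)).
Proof.
have [g gP] : exists g : forall j, M -> 'M[R[i]]_(r j), forall j,
    (forall x, triv_dom (a j) x -> triv_dom (b j) x ->
       forall v, triv (b j) x v = g j x *m triv (a j) x v) /\
    (forall k l, holomorphic_on (triv_dom (a j) `&` triv_dom (b j))
                   (fun x => g j x k l)).
  exists (fun j => sval (cid (triv_transition (a j) (b j)))) => j.
  exact: (svalP (cid (triv_transition (a j) (b j)))).
exists (fun x => \mxdiag_j g j x); split=> [x ax bx v|s t].
  rewrite mul_mxdiag_mxcol; apply/eq_mxcolP => j.
  exact: (gP j).1.
have [[i [u [v st]]]|st] := mxdiag_entry s t; last first.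
  by rewrite (_ : (fun x => _) = fun=> 0); [exact: holomorphic_on0 | apply/funext].
rewrite (_ : (fun x => _) = fun x => g i x u v); last first.
  by apply/funext => x; rewrite (st (fun j => g j x)).
by apply: holomorphic_on_sub ((gP i).2 u v) => x [ax bx].
Qed.

Definition direct_sum : holomorphic_bundle M (\sum_j r j) :=
  {| fiber := dsum_fiber;
     triv_dom := dsum_triv_dom;
     triv := dsum_triv;
     triv_dom_open := dsum_triv_dom_open;
     triv_cover := dsum_triv_cover;
     triv_bij := dsum_triv_bij;
     triv_transition := dsum_triv_transition |}.

End DirectSum.

Section GlobalSections.
Context {R : realType} {n : nat} {M : compact_complex_manifold R n} {r : nat}.
Variable E : holomorphic_bundle M r.

Definition H0 : set (forall x, E x) :=
  [set s | forall (a : triv_index E) (i : 'I_r),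
     holomorphic_on (triv_dom a) (fun x => triv a x (s x) i 0)].

Definition is_basis_H0 (N : nat) (s : 'I_N -> forall x, E x) : Prop :=
  (forall j, H0 (s j)) /\
  forall t, H0 t ->
    exists! c : 'rV[R[i]]_N, forall x, t x = \sum_j c 0 j *: s j x.

Definition dim_H0 (N : nat) : Prop :=
  exists s : 'I_N -> forall x, E x, is_basis_H0 s.

Definition globally_generated : Prop :=
  forall x (v : E x), exists2 s, H0 s & s x = v.

Section Kodaira.
Context {N : nat} (s : 'I_N -> forall x, E x).

Definition dual_evaluation (x : M) (xi : {linear E x -> R[i]^o}) : 'cV[R[i]]_N :=
  \col_j xi (s j x).

Definition kodaira (x : M) : set 'cV[R[i]]_N := range (@dual_evaluation x).

End Kodaira.

End GlobalSections.

(* Points of G(r, N) are the r-dimensional linear subspaces of C^N, as sets   *)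
(* of vectors. For each r-subset J of the N coordinates there is an affine    *)
(* chart, sending W to its unique basis matrix whose rows in J form the       *)
(* identity; only the other N - r rows vary. The charts cover G(r, N).        *)
Section Grassmannian.
Context {R : realType} {r N : nat}.
Implicit Types (W : set 'cV[R[i]]_N) (J : 'I_r -> 'I_N).

Definition grassmann_coord J W (Z : 'M[R[i]]_(N, r)) : Prop :=
  rowsub J Z = 1%:M /\ W = range (fun u : 'cV[R[i]]_r => Z *m u).

Definition grassmann_dom J : set (set 'cV[R[i]]_N) :=
  [set W | exists Z, grassmann_coord J W Z].

Definition grassmann_chart J W : 'M[R[i]]_(N, r) := xget 0 (grassmann_coord J W).

Definition grassmannian : set (set 'cV[R[i]]_N) :=
  \bigcup_(J in [set: 'I_r -> 'I_N]) grassmann_dom J.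

(* An injective holomorphic immersion; M being compact, it is automatically a *)
(* homeomorphism onto its image.                                              *)
Definition grassmann_embedding {n : nat} {M : compact_complex_manifold R n}
    (f : M -> set 'cV[R[i]]_N) : Prop :=
  [/\ forall x, grassmannian (f x),
      injective f,
      forall J, open (f @^-1` grassmann_dom J) /\
        forall i k, holomorphic_on (f @^-1` grassmann_dom J)
                      (fun x => grassmann_chart J (f x) i k) &
      forall J c x v, chart_dom c x -> grassmann_dom J (f x) -> v != 0 ->
        exists i k,
          cderive (fun p => grassmann_chart J (f (chart_inv c p)) i k)
            (chart c x) v != 0 ].

End Grassmannian.

Definition very_ample {R : realType} {n : nat}
    {M : compact_complex_manifold R n} {r : nat}
    (E : holomorphic_bundle M r) : Prop :=
  globally_generated E /\
  forall (N : nat) (s : 'I_N -> forall x, E x), is_basis_H0 s ->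
    @grassmann_embedding R r N n M (kodaira s).

Section HermitianMetrics.
Context {R : realType} {n : nat} {M : compact_complex_manifold R n} {r : nat}.
Variable E : holomorphic_bundle M r.

Definition adjmx {p q : nat} (A : 'M[R[i]]_(p, q)) : 'M[R[i]]_(q, p) :=
  map_mx Num.conj A^T.

Definition is_hermitian_metric (h : forall x, E x -> E x -> R[i]) : Prop :=
  [/\ forall x a (u v w : E x), h x (a *: u + v) w = a * h x u w + h x v w,
      forall x (v w : E x), h x w v = Num.conj (h x v w),
      forall x (v : E x), v != 0 -> 0 < h x v v &
      forall a : triv_index E, exists H : M -> 'M[R[i]]_r,
        (forall x, triv_dom a x -> forall v w : E x,
           h x v w = (adjmx (triv a x w) *m H x *m triv a x v) 0 0) /\
        forall i j, csmooth_on (triv_dom a) (fun x => H x i j) ].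

Definition flat_metric {N : nat} (v w : 'cV[R[i]]_N) : R[i] :=
  (adjmx w *m v) 0 0.

(* v in E_x is the functional xi(s(x)) |-> xi v on the subspace kodaira s x;  *)
(* this is the vector of the subspace representing it for flat_metric.        *)
Definition riesz_vector {N : nat} (s : 'I_N -> forall x, E x) (x : M) (v : E x) :
    'cV[R[i]]_N :=
  xget 0 [set p | kodaira s x p /\
    forall xi : {linear E x -> R[i]^o},
      xi v = flat_metric (dual_evaluation s xi) p].

(* The pull-back of the dual metric; the swap is due to v |-> riesz_vector v  *)
(* being conjugate linear.                                                    *)
Definition kodaira_metric {N : nat} (s : 'I_N -> forall x, E x) (x : M)
    (v w : E x) : R[i] :=
  flat_metric (riesz_vector s w) (riesz_vector s v).

Definition cintegral (mu : {measure set (borel M) -> \bar R}) (f : M -> R[i]) :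
    R[i] :=
  Complex (\int[mu]_(x in [set: borel M]) complex.Re (f x))
          (\int[mu]_(x in [set: borel M]) complex.Im (f x)).

Definition L2_product (mu : {measure set (borel M) -> \bar R})
    (h : forall x, E x -> E x -> R[i]) (s t : forall x, E x) : R[i] :=
  (Complex (fine (mu [set: borel M])) 0)^-1 *
    cintegral mu (fun x => h x (s x) (t x)).

(* mu stands for the volume measure omega^n / n!.                             *)
Definition is_balanced (mu : {measure set (borel M) -> \bar R})
    (h : forall x, E x -> E x -> R[i]) : Prop :=
  is_hermitian_metric h /\
  exists (N : nat) (s : 'I_N -> forall x, E x),
    [/\ is_basis_H0 s,
        forall x (v w : E x), h x v w = kodaira_metric s v w &
        forall j k, L2_product mu h (s j) (s k) = r%:R / N%:R * (j == k)%:R ].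

Definition is_automorphism (F : forall x, {linear E x -> E x}) : Prop :=
  (forall x, bijective (F x)) /\
  forall a : triv_index E, exists Phi : M -> 'M[R[i]]_r,
    (forall x, triv_dom a x -> forall v, triv a x (F x v) = Phi x *m triv a x v) /\
    forall i j, holomorphic_on (triv_dom a) (fun x => Phi x i j).

(* Uniqueness is up to holomorphic automorphisms of E covering the identity:  *)
(* if s is a basis defining a balanced metric, then F s defines another one,  *)
(* isometric to it through F (for instance F = c id rescales the metric).     *)
Definition admits_unique_balanced (mu : {measure set (borel M) -> \bar R}) :
    Prop :=
  (exists h, is_balanced mu h) /\
  forall h h', is_balanced mu h -> is_balanced mu h' ->
    exists2 F : (forall x, {linear E x -> E x}), is_automorphism F &
      forall x (v w : E x), h' x v w = h x (F x v) (F x w).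

End HermitianMetrics.

(* Main.v *)
Require Import Defs.
From HB Require Import structures.
From mathcomp Require Import all_boot all_order all_algebra all_fingroup.
From mathcomp Require Import all_classical all_reals all_analysis.
From mathcomp Require Import complex.
From mathcomp Require Import measurable_realfun ring lra.

(* Write S(x) for the r x N matrix of a basis s of sections in a local frame. *)
(* Then h_s(v, w) = w^H (S S^H)^-1 v, and the Gram matrix of s at x is the    *)
(* orthogonal projection P(x) onto the row space of S(x); s is balanced iff   *)
(* the mean of P is the scalar matrix r / N.                                  *)
(*                                                                            *)
(* Uniqueness up to automorphism holds for every globally generated bundle.   *)
(* Let s and s A be balanced bases, with projections P and P', and put        *)
(* T = A A^H. The pointwise gap tr(P' A^H A) - tr(P T) is a squared norm that *)
(* vanishes iff T preserves the row space of S(x); its integral is zero since *)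
(* tr(A^H A) = tr(A A^H). It is continuous, and nonempty open sets have       *)
(* positive volume, so T commutes with every P(x). Hence so does T^(-1/2),    *)
(* which therefore induces a holomorphic automorphism of the bundle; this is  *)
(* the isometry between the two metrics.                                      *)
(*                                                                            *)
(* If E carries a balanced metric, and V is the space of coefficient vectors  *)
(* of the sections of a subbundle of rank q, with orthogonal projection Q,    *)
(* then tr(P Q) <= q pointwise, so dim(V) r / N <= q. Applied to all summands *)
(* of E, whose ranks add up to r and whose dimensions add up to N, this is an *)
(* equality for each of them. Conversely, when the ratios agree, the union of *)
(* balanced bases of the summands is a balanced basis of E.                   *)

Set Implicit Arguments.
Unset Strict Implicit.
Unset Printing Implicit Defensive.

Import Order.TTheory GRing.Theory Num.Theory.
Import numFieldNormedType.Exports.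

Local Open Scope classical_set_scope.
Local Open Scope ring_scope.

(** * Smooth and holomorphic functions *)

(** In a local frame a basis of sections is an r x N matrix S(x), and its Gram matrix for the pulled
    back metric is the orthogonal projection P(x) onto the row space of S(x) ([gram_row_proj]).
    Balancedness thus says that P has mean (r/N) 1, that is, tr(P X) has mean (r/N) tr X for every
    constant matrix X ([cintegral_tr_gram]). Both halves of the theorem play a pointwise trace
    estimate against this mean value.

    Equality of the ratios comes from a slope inequality. Let Q project onto the space of
    coefficient vectors of the sections of E_j. These sections take values in a subbundle of rank
    r_j, so tr(P Q) <= r_j pointwise ([mxtrace_row_proj_sub]), and averaging gives N_j r / N <= r_j
    ([balanced_slope]). Summed over j both sides give r, so no inequality is strict. Conversely, the
    union of balanced bases induces the orthogonal sum of the metrics ([union_kodaira_metric]); its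
    L2 Gram matrix is block diagonal with blocks (r_j/N_j) 1, which is a multiple of the identity
    when the ratios agree.

    For uniqueness ([balanced_unique]), let s and s A be balanced and T = A A^H. The nonnegative
    continuous gap of [row_proj_gap] has integral zero, so it vanishes identically, because nonempty
    open sets have positive volume ([volume_open_gt0], which rests on the positivity of omega^n,
    [wedge_power_oriented_frame_gt0]). Hence T commutes with every P(x), and so does D = T^(-1/2)
    ([gram_inv_sqrt]). Acting on coefficient vectors, D therefore preserves the kernel of every S(x)
    and descends to a holomorphic automorphism of the bundle ([holomorphic_induced_endo]), which
    carries one metric to the other ([induced_endo_isometry]). *)

Section ComplexParts.
Context {R : realType}.
Implicit Types z w : R[i].

Lemma complexRe_mul z w : complex.Re (z * w) =
  complex.Re z * complex.Re w - complex.Im z * complex.Im w.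
Proof. by case: z w => [a b] [c d]. Qed.

Lemma complexIm_mul z w : complex.Im (z * w) =
  complex.Re z * complex.Im w + complex.Im z * complex.Re w.
Proof. by case: z w => [a b] [c d]. Qed.

Lemma complexRe_inv z : complex.Re z^-1 =
  complex.Re z * (complex.Re z ^+ 2 + complex.Im z ^+ 2)^-1.
Proof. by case: z => [a b]. Qed.

Lemma complexIm_inv z : complex.Im z^-1 =
  - complex.Im z * (complex.Re z ^+ 2 + complex.Im z ^+ 2)^-1.
Proof. by case: z => [a b] /=; rewrite mulNr. Qed.

Lemma complexRe_conj z : complex.Re (Num.conj z) = complex.Re z.
Proof. by case: z => [a b]. Qed.

Lemma complexIm_conj z : complex.Im (Num.conj z) = - complex.Im z.
Proof. by case: z => [a b]. Qed.

End ComplexParts.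

Section SmoothFunctions.
Context {R : realType} {n : nat}.
Local Notation Cn := ('rV[R]_(n + n)).
Implicit Types (f g : Cn -> R) (U : set Cn).

(** Continuity and derivatives are taken in the ambient space, so the condition is pointwise and V
    need only contain p. *)
Lemma differentiability_class_local k U f :
  (forall p, U p -> exists2 V, V p & differentiability_class k V f) ->
  differentiability_class k U f.
Proof.
elim: k f => [|k IH] f /= H; split=> //.
- by move=> p /H[V Vp [cf _]]; exact: cf.
- by move=> p /H[V Vp [cf _]]; exact: cf.
- move=> v; split; first by move=> p /H[V Vp [_ /(_ v)[df _]]]; exact: df.
  by apply: IH => p /H[V Vp [_ /(_ v)[_ dc]]]; exists V.
Qed.

Lemma smooth_local U f :
  (forall p, U p -> exists2 V, V p & smooth V f) -> smooth U f.
Proof.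
move=> H k; apply: differentiability_class_local => p /H[V Vp sf].
by exists V => //; exact: sf.
Qed.

Lemma differentiability_classW k U f :
  differentiability_class k.+1 U f -> differentiability_class k U f.
Proof.
elim: k f => [|k IH] f; first by case.
case=> cf H; split=> // v; have [df dc] := H v.
by split=> //; exact: IH.
Qed.

Lemma eq_differentiability_class k U f g : open U ->
  (forall p, U p -> f p = g p) ->
  differentiability_class k U f -> differentiability_class k U g.
Proof.
move=> oU.
have near_fg (f' g' : Cn -> R) p :
    (forall p, U p -> f' p = g' p) -> U p -> \forall q \near p, f' q = g' q.
  by move=> e Up; apply: filterS e _; exact: open_nbhs_nbhs.
have cont f' g' p : (forall p, U p -> f' p = g' p) -> U p ->
    {for p, continuous f'} -> {for p, continuous g'}.
  move=> e Up cf; rewrite /prop_for /continuous_at -(e _ Up).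
  by apply: (cvg_trans _ cf); exact: (@near_eq_cvg _ _ (nbhs p) _ f' g' (near_fg _ _ _ e Up)).
elim: k f g => [|k IH] f g e [cf H]; split=> //.
- by move=> p Up; apply: (cont f) => //; exact: cf.
- by move=> p Up; apply: (cont f) => //; exact: cf.
- move=> v; have [df dc] := H v; split.
    by move=> p Up; apply: near_eq_derivable (df _ Up); exact: near_fg.
  by apply: IH dc => p Up; apply: near_eq_derive; exact: near_fg.
Qed.

Lemma differentiability_class_cst k U (a : R) :
  differentiability_class k U (fun=> a).
Proof. exact: smooth_cst. Qed.

Lemma differentiability_classD k U f g : open U ->
  differentiability_class k U f -> differentiability_class k U g ->
  differentiability_class k U (fun p => f p + g p).
Proof.
move=> oU; elim: k f g => [|k IH] f g [cf Hf] [cg Hg]; split=> //.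
- by move=> p Up; apply: continuousD; [exact: cf | exact: cg].
- by move=> p Up; apply: continuousD; [exact: cf | exact: cg].
- move=> v; have [df dcf] := Hf v; have [dg dcg] := Hg v; split.
    by move=> p Up; apply: derivableD; [exact: df | exact: dg].
  apply: eq_differentiability_class (IH _ _ dcf dcg) => // p Up.
  by rewrite -deriveD //; [exact: df | exact: dg].
Qed.

Lemma differentiability_classM k U f g : open U ->
  differentiability_class k U f -> differentiability_class k U g ->
  differentiability_class k U (fun p => f p * g p).
Proof.
move=> oU; elim: k f g => [|k IH] f g Hf0 Hg0; have [cf Hf] := Hf0; have [cg Hg] := Hg0; split=> //.
- by move=> p Up; apply: continuousM; [exact: cf | exact: cg].
- by move=> p Up; apply: continuousM; [exact: cf | exact: cg].
- move=> v; have [df dcf] := Hf v; have [dg dcg] := Hg v; split.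
    by move=> p Up; apply: derivableM; [exact: df | exact: dg].
  have := differentiability_classD oU
    (IH _ _ (differentiability_classW Hf0) dcg) (IH _ _ (differentiability_classW Hg0) dcf).
  apply: eq_differentiability_class => // p Up.
  by rewrite -[RHS]/('D_v (f * g) p) deriveM //; [exact: df | exact: dg].
Qed.

Lemma differentiability_classV k U f : open U -> (forall p, U p -> f p != 0) ->
  differentiability_class k U f ->
  differentiability_class k U (fun p => (f p)^-1).
Proof.
move=> oU f0; elim: k => [|k IH] Hf0; have [cf Hf] := Hf0; split=> //.
- by move=> p Up; apply: cvgV (cf _ Up); exact: f0.
- by move=> p Up; apply: cvgV (cf _ Up); exact: f0.
- move=> v; have [df dcf] := Hf v; split.
    by move=> p Up; apply: derivableV; [exact: f0 | exact: df].
  have cV := IH (differentiability_classW Hf0).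
  have := differentiability_classM oU (differentiability_class_cst k U (-1))
    (differentiability_classM oU (differentiability_classM oU cV cV) dcf).
  apply: eq_differentiability_class => // p Up.
  rewrite deriveV; [|exact: f0 | exact: df].
  by rewrite scaleNr mulN1r -exprVn expr2.
Qed.

Lemma smoothD U f g : open U -> smooth U f -> smooth U g ->
  smooth U (fun p => f p + g p).
Proof. by move=> oU sf sg k; exact: differentiability_classD. Qed.

Lemma smoothM U f g : open U -> smooth U f -> smooth U g ->
  smooth U (fun p => f p * g p).
Proof. by move=> oU sf sg k; exact: differentiability_classM. Qed.

Lemma smoothV U f : open U -> (forall p, U p -> f p != 0) -> smooth U f ->
  smooth U (fun p => (f p)^-1).
Proof. by move=> oU f0 sf k; exact: differentiability_classV. Qed.

Lemma smoothN U f : open U -> smooth U f -> smooth U (fun p => - f p).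
Proof.
move=> oU sf; have := smoothM oU (smooth_cst U (-1)) sf.
by under eq_fun do rewrite mulN1r.
Qed.

Lemma eq_smooth U f g : open U -> (forall p, U p -> f p = g p) ->
  smooth U f -> smooth U g.
Proof. by move=> oU e sf k; apply: eq_differentiability_class (sf k). Qed.

Lemma smooth_continuous U f p : smooth U f -> U p -> {for p, continuous f}.
Proof. by move=> /(_ 0%N)[cf _]; exact: cf. Qed.

Lemma smooth_derivable U f p v : smooth U f -> U p -> derivable f p v.
Proof. by move=> /(_ 1%N)[_ /(_ v)[df _]]; exact: df. Qed.

End SmoothFunctions.

Section HolomorphicFunctions.
Context {R : realType} {n : nat}.
Local Notation Cn := ('rV[R]_(n + n)).
Implicit Types (f g : Cn -> R[i]) (U : set Cn).

Lemma csmooth_local U f :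
  (forall p, U p -> exists2 V, V p & csmooth V f) -> csmooth U f.
Proof.
by move=> H; split; apply: smooth_local => p /H[V Vp [sR sI]]; exists V.
Qed.

Lemma csmooth_cst U (a : R[i]) : csmooth U (fun=> a).
Proof. by split; exact: smooth_cst. Qed.

Lemma holomorphic_local U f :
  (forall p, U p -> exists2 V, V p & holomorphic V f) -> holomorphic U f.
Proof.
move=> H; split; first by apply: csmooth_local => p /H[V Vp [sf _]]; exists V.
by move=> p v /H[V Vp [_ CR]]; exact: CR.
Qed.

Lemma eq_holomorphic U f g : open U -> (forall p, U p -> f p = g p) ->
  holomorphic U f -> holomorphic U g.
Proof.
move=> oU e [[sR sI] CR]; split.
  by split; [apply: eq_smooth sR | apply: eq_smooth sI] => // p /e ->.
move=> p v Up; rewrite [in RHS]/cderive [LHS]/cderive.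
have E w : 'D_w (fun q => complex.Re (g q)) p = 'D_w (fun q => complex.Re (f q)) p
    /\ 'D_w (fun q => complex.Im (g q)) p = 'D_w (fun q => complex.Im (f q)) p.
  by split; apply: near_eq_derive; apply: filterS (open_nbhs_nbhs (conj oU Up)) => q /e ->.
by rewrite !(E _).1 !(E _).2; exact: CR.
Qed.

Lemma holomorphic_cst U (a : R[i]) : holomorphic U (fun=> a).
Proof.
split; first exact: csmooth_cst.
by move=> p v _; rewrite /cderive !derive_cst mulr0.
Qed.

Lemma holomorphicD U f g : open U -> holomorphic U f -> holomorphic U g ->
  holomorphic U (fun p => f p + g p).
Proof.
move=> oU [[fR fI] fC] [[gR gI] gC]; split.
  split; [apply: eq_smooth (smoothD oU fR gR) | apply: eq_smooth (smoothD oU fI gI)] => // p _;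
  by rewrite raddfD.
move=> p v Up.
have E w : cderive (fun q => f q + g q) p w = cderive f p w + cderive g p w.
  rewrite /cderive.
  under eq_fun do rewrite raddfD/=.
  under [X in Complex _ ('D_w X p)]eq_fun do rewrite raddfD/=.
  by rewrite !deriveD //; exact: (@smooth_derivable _ _ U).
by rewrite !E mulrDr fC // gC.
Qed.

Lemma cderiveM U f g p w : csmooth U f -> csmooth U g -> U p ->
  cderive (fun q => f q * g q) p w = f p * cderive g p w + g p * cderive f p w.
Proof.
move=> [fR fI] [gR gI] Up; rewrite /cderive.
under eq_fun do rewrite complexRe_mul.
under [X in Complex _ ('D_w X p)]eq_fun do rewrite complexIm_mul.
have dR := smooth_derivable fR Up (v := w); have dI := smooth_derivable fI Up (v := w).
have eR := smooth_derivable gR Up (v := w); have eI := smooth_derivable gI Up (v := w).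
have dM := fun a b da db => @deriveM _ _ a b p w da db.
rewrite (deriveB (derivableM dR eR) (derivableM dI eI)).
rewrite (deriveD (derivableM dR eI) (derivableM dI eR)).
rewrite (dM _ _ dR eR) (dM _ _ dI eI) (dM _ _ dR eI) (dM _ _ dI eR).
move: ('D_w _ p) ('D_w _ p) ('D_w _ p) ('D_w _ p) => a' b' c' d'.
move: (f p) (g p) => [a b] [c d] /=; rewrite /GRing.scale /=.
by congr Complex; ring.
Qed.

Lemma holomorphicM U f g : open U -> holomorphic U f -> holomorphic U g ->
  holomorphic U (fun p => f p * g p).
Proof.
move=> oU [sf fC] [sg gC]; have [fR fI] := sf; have [gR gI] := sg; split.
  split.
    apply: eq_smooth (smoothD oU (smoothM oU fR gR) (smoothN oU (smoothM oU fI gI))) => // p _.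
    by rewrite complexRe_mul.
  apply: eq_smooth (smoothD oU (smoothM oU fR gI) (smoothM oU fI gR)) => // p _.
  by rewrite complexIm_mul.
move=> p v Up; rewrite !(cderiveM _ sf sg Up) fC // gC //; ring.
Qed.

Lemma holomorphicV U f : open U -> (forall p, U p -> f p != 0) ->
  holomorphic U f -> holomorphic U (fun p => (f p)^-1).
Proof.
move=> oU f0 hf; have [sf fC] := hf; have [fR fI] := sf.
have sV : csmooth U (fun p => (f p)^-1).
  have sN : smooth U (fun p => (complex.Re (f p) ^+ 2 + complex.Im (f p) ^+ 2)^-1).
    apply: smoothV => //; last by apply: smoothD => //; exact: smoothM.
    move=> p /f0; case: (f p) => a b; rewrite eq_complex /= negb_and.
    by rewrite paddr_eq0 ?sqr_ge0 // !sqrf_eq0 negb_and.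
  split.
    apply: eq_smooth (smoothM oU fR sN) => // p _; by rewrite complexRe_inv.
  apply: eq_smooth (smoothM oU (smoothN oU fI) sN) => // p _.
  by rewrite complexIm_inv.
split => // p v Up.
(* Differentiating f / f, which is constant near p, gives the derivative of the inverse without
   computing its real and imaginary parts. *)
have E w : cderive (fun q => (f q)^-1) p w = - (f p)^-1 ^+ 2 * cderive f p w.
  have := cderiveM w sf sV Up.
  have -> : cderive (fun q => f q / f q) p w = 0.
    have near_cst (F : Cn -> R) a : (forall q, U q -> F q = a) -> 'D_w F p = 0.
      move=> Fa; rewrite (_ : 0 = 'D_w (fun=> a) p); last first.
        by apply/esym; exact: derive_cst.
      by apply: near_eq_derive; apply: filterS (open_nbhs_nbhs (conj oU Up)).
    rewrite /cderive (near_cst _ 1) ?(near_cst _ 0) // => q /f0 fq;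
      by rewrite divff.
  move=> /esym/eqP; rewrite addr_eq0 => /eqP e.
  apply: (mulfI (f0 _ Up)); rewrite e.
  by rewrite mulrA mulrN expr2 !mulrA divff ?f0 // mul1r mulNr.
by rewrite !E fC // mulrCA.
Qed.

End HolomorphicFunctions.

(** * Adjoints and orthogonal projections *)

Section Adjoint.
Context {R : realType}.
Local Notation C := R[i].

Lemma adjmxK {p q} (A : 'M[C]_(p, q)) : adjmx (adjmx A) = A.
Proof. by apply/matrixP => i j; rewrite !mxE conjCK. Qed.

Lemma adjmxM {p q s} (A : 'M[C]_(p, q)) (B : 'M[C]_(q, s)) :
  adjmx (A *m B) = adjmx B *m adjmx A.
Proof. by rewrite /adjmx trmx_mul map_mxM. Qed.

Lemma adjmxB {p q} (A B : 'M[C]_(p, q)) : adjmx (A - B) = adjmx A - adjmx B.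
Proof. by rewrite /adjmx linearB /= map_mxB. Qed.

Lemma adjmx1 {p} : adjmx (1%:M : 'M[C]_p) = 1%:M.
Proof. by rewrite /adjmx trmx1 map_mx1. Qed.

Lemma adjmx_inv {p} (A : 'M[C]_p) : adjmx (invmx A) = invmx (adjmx A).
Proof. by rewrite /adjmx trmx_inv map_invmx. Qed.

Lemma adjmx_unit {p} (A : 'M[C]_p) : (adjmx A \in unitmx) = (A \in unitmx).
Proof. by rewrite /adjmx map_unitmx unitmx_tr. Qed.

Lemma mxtrace_adj_mul {p q} (X : 'M[C]_(p, q)) :
  \tr (adjmx X *m X) = \sum_j \sum_i `|X i j| ^+ 2.
Proof.
apply: eq_bigr => j _; rewrite mxE; apply: eq_bigr => i _.
by rewrite !mxE normCK mulrC.
Qed.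

Lemma mxtrace_adj_mul_ge0 {p q} (X : 'M[C]_(p, q)) : 0 <= \tr (adjmx X *m X).
Proof.
rewrite mxtrace_adj_mul; apply: sumr_ge0 => j _; apply: sumr_ge0 => i _.
by rewrite exprn_ge0.
Qed.

Lemma mxtrace_adj_mul_eq0 {p q} (X : 'M[C]_(p, q)) :
  \tr (adjmx X *m X) = 0 -> X = 0.
Proof.
rewrite mxtrace_adj_mul => /eqP; rewrite psumr_eq0; last first.
  by move=> j _; apply: sumr_ge0 => i _; rewrite exprn_ge0.
move=> /allP X0; apply/matrixP => i j; rewrite mxE.
have /implyP/(_ isT) := X0 j (mem_index_enum _).
rewrite psumr_eq0; last by move=> k _; rewrite exprn_ge0.
move=> /allP/(_ i (mem_index_enum _)) /implyP/(_ isT).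
by rewrite sqrf_eq0 normr_eq0 => /eqP.
Qed.

Lemma mul_adjmx_eq0 {p q} (X : 'M[C]_(p, q)) : X *m adjmx X = 0 -> X = 0.
Proof.
move=> X0; rewrite -[X]adjmxK (@mxtrace_adj_mul_eq0 _ _ (adjmx X)).
  by apply/matrixP => i j; rewrite !mxE rmorph0.
by rewrite adjmxK X0 mxtrace0.
Qed.

Lemma gram_unitmx {p q} (X : 'M[C]_(p, q)) :
  row_free X -> X *m adjmx X \in unitmx.
Proof.
move=> fX; rewrite -row_free_unit; apply: inj_row_free => v vX.
apply: (row_free_inj fX); rewrite mul0mx; apply: mul_adjmx_eq0.
by rewrite adjmxM mulmxA -(mulmxA v) vX mul0mx.
Qed.

(** For a row-free X, the orthogonal projection onto its row space, acting on row vectors from the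
    right. *)
Definition row_proj {p q} (X : 'M[C]_(p, q)) : 'M[C]_q :=
  adjmx X *m invmx (X *m adjmx X) *m X.

Lemma row_proj_adj {p q} (X : 'M[C]_(p, q)) : adjmx (row_proj X) = row_proj X.
Proof. by rewrite /row_proj !adjmxM adjmx_inv adjmxM adjmxK mulmxA. Qed.

Lemma mul_row_proj {p q} (X : 'M[C]_(p, q)) :
  row_free X -> X *m row_proj X = X.
Proof. by move=> fX; rewrite /row_proj !mulmxA mulmxV ?mul1mx ?gram_unitmx. Qed.

Lemma row_proj_idem {p q} (X : 'M[C]_(p, q)) :
  row_free X -> row_proj X *m row_proj X = row_proj X.
Proof.
by move=> fX; rewrite {1}/row_proj -mulmxA mul_row_proj.
Qed.

Lemma mxtrace_row_proj {p q} (X : 'M[C]_(p, q)) :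
  row_free X -> \tr (row_proj X) = p%:R.
Proof.
move=> fX; rewrite /row_proj mxtrace_mulC !mulmxA mulmxV ?gram_unitmx //.
exact: mxtrace1.
Qed.

(** With P and P' the two projections, p - tr(P P') = tr(P (1 - P')) is the squared norm of P (1 -
    P'). *)
Lemma mxtrace_row_projM {p q s} (X : 'M[C]_(p, q)) (Y : 'M[C]_(s, q)) :
  row_free X -> row_free Y -> \tr (row_proj X *m row_proj Y) <= p%:R.
Proof.
move=> fX fY; rewrite -subr_ge0 -(mxtrace_row_proj fX) -raddfB /=.
rewrite -[X in X - _]mulmx1 -mulmxBr.
set P := row_proj X; set Q := 1%:M - row_proj Y.
have QQ : Q *m Q = Q.
  rewrite /Q mulmxBr mulmx1 mulmxBl mul1mx row_proj_idem //.
  by rewrite subrr subr0.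
have aQ : adjmx Q = Q by rewrite /Q adjmxB adjmx1 row_proj_adj.
have PP : P *m P = P by exact: row_proj_idem.
rewrite -QQ mulmxA mxtrace_mulC -PP.
by have := mxtrace_adj_mul_ge0 (P *m Q); rewrite adjmxM aQ row_proj_adj !mulmxA.
Qed.

(* On the column space of U, the projection onto the row space of S agrees   *)
(* with the projection onto a subspace of dimension q.                       *)
Lemma mxtrace_row_proj_sub {r N p q} (S : 'M[C]_(r, N)) (L : 'M[C]_(r, q))
    (L' : 'M[C]_(q, r)) (U : 'M[C]_(N, p)) (Y : 'M[C]_(q, p)) :
  row_free S -> L' *m L = 1%:M -> row_free (adjmx U) -> S *m U = L *m Y ->
  \tr (row_proj S *m row_proj (adjmx U)) <= q%:R.
Proof.
move=> fS L'L fU SU; set h := invmx (S *m adjmx S).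
have hu := gram_unitmx fS.
have ah : adjmx h = h by rewrite /h adjmx_inv adjmxM adjmxK.
(* From S U = L Y follows P U = S^H h L Y = X^H Y, where P is the projection of S. The image of U
   under P thus lies in the column space of X^H, of dimension q. *)
have [X XE] : exists X, X = adjmx L *m h *m S by exists (adjmx L *m h *m S).
have aX : adjmx X = adjmx S *m h *m L by rewrite XE !adjmxM adjmxK ah mulmxA.
have fX : row_free X.
  apply: inj_row_free => v vX.
  have : v *m (X *m adjmx S) = 0 by rewrite mulmxA vX mul0mx.
  rewrite XE -mulmxA mulmxKV // => vL.
  have := congr1 (mulmx^~ (adjmx L')) vL.
  by rewrite -mulmxA -adjmxM L'L adjmx1 mulmx1 mul0mx.
have XX : X *m adjmx X = adjmx L *m h *m L.
  by rewrite aX XE !mulmxA -(mulmxA _ S) -(mulmxA _ (S *m _)) mulmxV // mulmx1.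
have XU : row_proj X *m U = row_proj S *m U.
  rewrite /row_proj -!mulmxA SU.
  have -> : X *m U = (X *m adjmx X) *m Y by rewrite XX XE -!mulmxA SU.
  by rewrite mulKmx ?gram_unitmx // aX !mulmxA.
rewrite (_ : _ *m _ = row_proj X *m row_proj (adjmx U)); last first.
  by rewrite {2 4}/row_proj adjmxK !mulmxA XU.
exact: mxtrace_row_projM.
Qed.

Lemma mxtrace_mul4 {a b c d} (X : 'M[C]_(a, b)) (Y : 'M[C]_(b, c))
    (Z : 'M[C]_(c, d)) (W : 'M[C]_(d, a)) :
  \tr (X *m Y *m Z *m W) = \tr (Y *m (Z *m W *m X)).
Proof. by rewrite -(mulmxA _ Z) -(mulmxA X) [LHS]mxtrace_mulC -(mulmxA Y). Qed.

(* This identity plays the role of the convexity of log det in the           *)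
(* Kempf-Ness argument.                                                      *)
Lemma row_proj_gap {r N} (S : 'M[C]_(r, N)) (A : 'M[C]_N) :
  row_free S -> A \in unitmx -> exists Z : 'M[C]_N,
  \tr (row_proj (S *m A) *m (adjmx A *m A)) - \tr (row_proj S *m (A *m adjmx A))
    = \tr (adjmx Z *m Z) /\
  (Z = 0 -> row_proj S *m (A *m adjmx A) = (A *m adjmx A) *m row_proj S).
Proof.
move=> fS uA.
have [T TE] : {T | T = A *m adjmx A} by exists (A *m adjmx A).
have [P PE] : {P | P = row_proj S} by exists (row_proj S).
have [h hE] : {h | h = invmx (S *m adjmx S)} by exists (invmx (S *m adjmx S)).
have [G GdE] : {G | G = S *m A *m adjmx (S *m A)}.
  by exists (S *m A *m adjmx (S *m A)).
have PP : P *m P = P by rewrite PE row_proj_idem.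
have aP : adjmx P = P by rewrite PE row_proj_adj.
have PhE : P = adjmx S *m h *m S by rewrite PE hE.
have aT : adjmx T = T by rewrite TE adjmxM adjmxK.
have fSA : row_free (S *m A).
  apply: inj_row_free => v; rewrite mulmxA => /(congr1 (mulmx^~ (invmx A))).
  rewrite mulmxK // mul0mx => vS; apply: (row_free_inj fS).
  by rewrite vS mul0mx.
have uG : G \in unitmx by rewrite GdE gram_unitmx.
have GE : G = S *m T *m adjmx S by rewrite GdE TE adjmxM !mulmxA.
have aG : adjmx G = G by rewrite GdE adjmxM adjmxK.
(* K measures the failure of T to preserve the row space of S. *)
have [K KE] : {K | K = S *m T *m (1%:M - P)} by exists (S *m T *m (1%:M - P)).
have KK : K *m adjmx K = S *m T *m T *m adjmx S - G *m h *m G.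
  rewrite KE !adjmxM adjmxB adjmx1 aP aT !mulmxA -(mulmxA _ (1%:M - P)).
  rewrite mulmxBr mulmx1 mulmxBl mul1mx PP subrr subr0 mulmxBr mulmx1 !mulmxBl.
  by rewrite GE PhE !mulmxA.
(* Y is chosen with Y Y^H = G^-1, so that the gap tr(G^-1 K K^H) is the squared norm of Z = Y^H
   K. *)
have [Y YE] : {Y | Y = invmx G *m S *m A} by exists (invmx G *m S *m A).
have aY : adjmx Y = adjmx (S *m A) *m invmx G.
  by rewrite YE -(mulmxA (invmx G)) (adjmxM (invmx G)) adjmx_inv aG.
have YY : Y *m adjmx Y = invmx G.
  by rewrite aY YE -(mulmxA (invmx G)) -mulmxA (mulmxA (S *m A)) -GdE mulmxV ?mulmx1.
exists (adjmx Y *m K); split.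
  have -> : adjmx (adjmx Y *m K) *m (adjmx Y *m K) = adjmx K *m (invmx G *m K).
    by rewrite adjmxM adjmxK -mulmxA (mulmxA Y) YY.
  rewrite [RHS]mxtrace_mulC -[in RHS]mulmxA KK mulmxBr.
  rewrite raddfB /=; congr (_ - _).
    rewrite /row_proj -GdE mxtrace_mul4; congr (\tr (_ *m _)).
    by rewrite adjmxM TE !mulmxA.
  by rewrite -TE -PE PhE mxtrace_mul4 -GE -(mulmxA G) mulKmx.
move=> Z0.
have K0 : K = 0.
  have := congr1 (mulmx Y) Z0.
  rewrite mulmxA YY mulmx0 => /(congr1 (mulmx G)).
  by rewrite mulmxA mulmxV // mul1mx mulmx0.
(* The right-hand side is hermitian, so P T equals its adjoint T P. *)
have PT : P *m T = P *m T *m P.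
  move: K0; rewrite KE mulmxBr mulmx1 => /eqP; rewrite subr_eq0 => /eqP e.
  by rewrite {1}PhE -!mulmxA e PhE !mulmxA.
rewrite -TE -PE; have := congr1 adjmx PT.
by rewrite !adjmxM aP aT => ->; rewrite mulmxA.
Qed.

Lemma spectral_hermitian {p} (H : 'M[C]_p) : adjmx H = H ->
  exists (U : 'M[C]_p) (d : 'rV_p), [/\ U *m adjmx U = 1%:M, adjmx U *m U = 1%:M &
    H = adjmx U *m diag_mx d *m U].
Proof.
move=> aH.
have nH : H \is normalmx by apply/normalmxP; move: aH; rewrite /adjmx => ->.
have /orthomx_spectralP HE := nH.
have Uu := spectral_unitarymx H.
have UU : spectralmx H *m adjmx (spectralmx H) = 1%:M by apply/unitarymxP.
exists (spectralmx H), (spectral_diag H); split=> //.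
  by rewrite (mulmx1C UU).
by rewrite {1}HE invmx_unitary.
Qed.

Lemma hermitian_posdef_gram {p} (H : 'M[C]_p) : adjmx H = H ->
  (forall v : 'cV[C]_p, v != 0 -> 0 < (adjmx v *m H *m v) 0 0) ->
  exists2 Theta : 'M[C]_p, Theta \in unitmx & H = adjmx Theta *m Theta.
Proof.
move=> aH Hpos; have [U [d [UU UU' HE]]] := spectral_hermitian aH.
have uU : U \in unitmx by case/mulmx1_unit: UU.
have dpos i : 0 < d 0 i.
  pose w : 'cV[C]_p := delta_mx i 0.
  have := Hpos (adjmx U *m w); rewrite HE adjmxM adjmxK => /(_ _).
  have -> : (adjmx w *m U *m (adjmx U *m diag_mx d *m U) *m (adjmx U *m w)) 0 0
      = d 0 i.
    rewrite !mulmxA -(mulmxA _ U) UU mulmx1 -(mulmxA _ U) UU mulmx1.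
    rewrite mxE (bigD1 i) //= big1 => [|k ki]; last by rewrite !mxE (negPf ki) mulr0.
    rewrite addr0 mxE (bigD1 i) //= big1 => [|k ki].
      by rewrite !mxE !eqxx /= rmorph1 mulr1n mul1r mulr1 addr0.
    by rewrite !mxE (negPf ki) rmorph0 mul0r.
  apply; apply/eqP => /(congr1 (mulmx U)); rewrite mulmxA UU mul1mx mulmx0.
  by move=> /matrixP/(_ i 0); rewrite !mxE !eqxx => /eqP; rewrite oner_eq0.
pose e := \row_i sqrtC (d 0 i).
have ee : adjmx (diag_mx e) *m diag_mx e = diag_mx d.
  rewrite /adjmx tr_diag_mx map_diag_mx mulmx_diag; congr diag_mx.
  apply/rowP => i; rewrite !mxE /= conj_Creal ?realE ?sqrtC_ge0 ?(ltW (dpos i)) //.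
  by rewrite -expr2 sqrtCK.
exists (diag_mx e *m U).
  rewrite unitmx_mul uU andbT unitmxE det_diag unitfE.
  by apply/prodf_neq0 => i _; rewrite mxE sqrtC_eq0 gt_eqF.
by rewrite adjmxM -mulmxA (mulmxA _ (diag_mx e)) ee HE mulmxA.
Qed.

(** D is the inverse square root of T = A A^H, formed in a unitary eigenbasis. Being a function of
    T, it commutes with whatever T commutes with. *)
Lemma gram_inv_sqrt {N} (A : 'M[C]_N) : A \in unitmx ->
  exists D : 'M[C]_N, [/\ adjmx D = D, D \in unitmx,
    D *m (A *m adjmx A) *m D = 1%:M &
    forall P, P *m (A *m adjmx A) = (A *m adjmx A) *m P -> P *m D = D *m P].
Proof.
move=> uA; set T := A *m adjmx A.
have aT : adjmx T = T by rewrite /T adjmxM adjmxK.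
have [U [d [UU UU' TE]]] := spectral_hermitian aT.
have uU : U \in unitmx by case/mulmx1_unit: UU.
have dE : diag_mx d = (U *m A) *m adjmx (U *m A).
  rewrite adjmxM mulmxA -(mulmxA U) -/T TE !mulmxA UU mul1mx.
  by rewrite -mulmxA UU mulmx1.
have dpos i : 0 < d 0 i.
  have : diag_mx d i i = \sum_k `|(U *m A) i k| ^+ 2.
    by rewrite dE; move: (U *m A) => B; rewrite mxE; apply: eq_bigr => k _; rewrite !mxE normCK.
  rewrite mxE eqxx mulr1n => di; rewrite lt_def di sumr_ge0 ?andbT; last first.
    by move=> k _; rewrite exprn_ge0.
  rewrite -di; apply/eqP => d0.
  have : diag_mx d \in unitmx.
    by rewrite dE unitmx_mul adjmx_unit andbb unitmx_mul uU.
  by rewrite unitmxE det_diag unitfE => /prodf_neq0/(_ i isT); rewrite d0 eqxx.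
pose e := \row_i (sqrtC (d 0 i))^-1.
have ede : diag_mx e *m diag_mx d *m diag_mx e = 1%:M.
  rewrite !mulmx_diag -diag_const_mx; congr diag_mx; apply/rowP => i; rewrite !mxE.
  rewrite mulrAC -invfM -expr2 sqrtCK mulVf ?gt_eqF //.
have ae : adjmx (diag_mx e) = diag_mx e.
  rewrite /adjmx tr_diag_mx map_diag_mx; congr diag_mx; apply/rowP => i; rewrite !mxE.
  by rewrite /= conj_Creal // realE invr_ge0 sqrtC_ge0 (ltW (dpos i)).
exists (adjmx U *m diag_mx e *m U); split.
- by rewrite !adjmxM adjmxK ae mulmxA.
- rewrite !unitmx_mul adjmx_unit uU andbT /= unitmxE det_diag unitfE.
  by apply/prodf_neq0 => i _; rewrite mxE invr_eq0 sqrtC_eq0 gt_eqF.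
- rewrite TE !mulmxA -(mulmxA _ U) UU mulmx1 -(mulmxA _ U) UU mulmx1.
  rewrite -(mulmxA (adjmx U)) -(mulmxA (adjmx U)) ede.
  by rewrite mulmx1.
- move=> P; rewrite TE => PT.
  have [Q QE] : {Q | Q = U *m P *m adjmx U} by exists (U *m P *m adjmx U).
  have Qd : Q *m diag_mx d = diag_mx d *m Q.
    have := congr1 (fun X => U *m X *m adjmx U) PT.
    rewrite QE !mulmxA UU mul1mx -!mulmxA UU mulmx1.
    by rewrite !mulmxA.
  have Qe : Q *m diag_mx e = diag_mx e *m Q.
    (* Entrywise, Q i j is nonzero only between equal eigenvalues, where the corresponding entries
       of e agree too. *)
    apply/matrixP => i j; move/matrixP/(_ i j): Qd.
    rewrite !mul_mx_diag !mul_diag_mx !mxE => Qij.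
    have [->|ne] := eqVneq (Q i j) 0; first by rewrite mulr0 mul0r.
    have : d 0 j = d 0 i by apply: (mulfI ne); rewrite Qij mulrC.
    by move=> ->; rewrite mulrC.
  have PE : P = adjmx U *m Q *m U.
    by rewrite QE !mulmxA UU' mul1mx -mulmxA UU' mulmx1.
  rewrite PE -!mulmxA (mulmxA U (adjmx U)) UU mul1mx (mulmxA Q) Qe.
  by rewrite (mulmxA U (adjmx U)) UU mul1mx !mulmxA.
Qed.

End Adjoint.

(** * The volume of a nonempty open set is positive *)

(** Conjugation by the bijection [tau] preserves signs. This passes from the frame ordered as e_1, i
    e_1, e_2, i e_2, etc. to the coordinates of R^(n + n). *)
Lemma sum_perm_relabel (K : pzRingType) (m1 m2 : nat) (tau : 'I_m1 -> 'I_m2)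
    (F : ('I_m1 -> 'I_m2) -> K) : m1 = m2 -> injective tau ->
  \sum_(s : 'S_m1) (-1) ^+ s * F (fun k => tau (s k)) =
  \sum_(s : 'S_m2) (-1) ^+ s * F (fun k => s (tau k)).
Proof.
move=> e; subst m2 => tau_inj; pose t := perm tau_inj.
rewrite [RHS](reindex_inj (@conjg_inj _ t)); apply: eq_bigr => s _.
rewrite odd_permJ; congr (_ * F _); apply/funext => k.
have tE j : tau j = t j by rewrite permE.
by rewrite !tE -!permM conjgE !mulgA mulgV mul1g.
Qed.

(** * Pfaffian sums and the sign of omega^n *)

Section AlternatingSum.
Context {K : numDomainType} {n : nat}.
Implicit Types X : 'I_n -> 'I_(n + n) -> 'I_(n + n) -> K.

(* When X does not depend on i, this is 2^n n! times the Pfaffian of its     *)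
(* skew-symmetric part.                                                      *)
Definition alternating_sum X : K :=
  \sum_(s : 'S_(n + n)) (-1) ^+ s *
    \prod_(i < n) X i (s (lshift n i)) (s (rshift n i)).

(** Exchanging the two arguments of the factor at i0 preserves the product and reverses the sign of
    the permutation, so the sum is its own opposite. *)
Lemma alternating_sum_sym X i0 :
  (forall a b, X i0 a b = X i0 b a) -> alternating_sum X = 0.
Proof.
move=> X0; set t := tperm (lshift n i0) (rshift n i0).
have : alternating_sum X = - alternating_sum X.
  rewrite {1}/alternating_sum (reindex_inj (@mulgI _ t)) /= -sumrN.
  apply: eq_bigr => s _; rewrite odd_mul_tperm eq_lrshift signr_addb /=.
  rewrite expr1 mulN1r mulNr; congr (- (_ * _)); apply: eq_bigr => i _.
  rewrite !permM; have [->|ne] := eqVneq i i0; first by rewrite tpermL tpermR X0.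
  rewrite !tpermD // ?eq_lrshift ?eq_rlshift //.
    by rewrite (inj_eq (@rshift_inj _ _)) eq_sym.
  by rewrite (inj_eq (@lshift_inj _ _)) eq_sym.
by move/eqP; rewrite eq_sym eqNr => /eqP.
Qed.

(** Expand the product over the set J of factors that contribute S; every term with J nonempty has a
    symmetric factor and vanishes. *)
Lemma alternating_sum_add_sym (S W : 'I_(n + n) -> 'I_(n + n) -> K) :
  (forall a b, S a b = S b a) ->
  alternating_sum (fun _ a b => S a b + W a b) = alternating_sum (fun=> W).
Proof.
move=> Ssym; rewrite /alternating_sum.
under eq_bigr do rewrite bigA_distr mulr_sumr.
rewrite exchange_big (bigD1 finset.set0) //= [X in _ + X]big1 ?addr0.
  by apply: eq_bigr => s _; congr (_ * _); apply: eq_bigr => i _; rewrite inE.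
move=> J /finset.set0Pn[i0 i0J].
have := @alternating_sum_sym (fun i => if i \in J then S else W) i0.
rewrite i0J => /(_ Ssym); rewrite /alternating_sum => E; rewrite -[RHS]E.
apply: eq_bigr => s _; congr (_ * _); apply: eq_bigr => i _; by case: (i \in J).
Qed.

(** Here f i is the index k chosen in the i-th factor; for a fixed f the sum over permutations is a
    Leibniz expansion. *)
Lemma alternating_sum_gram (A B : 'M[K]_(n, n + n)) :
  alternating_sum (fun _ a b => \sum_k A k a * B k b) =
  \sum_(f : {ffun 'I_n -> 'I_n}) \det (col_mx (rowsub f A) (rowsub f B)).
Proof.
rewrite /alternating_sum.
under eq_bigr do rewrite bigA_distr_bigA mulr_sumr.
rewrite exchange_big; apply: eq_bigr => f _; apply: eq_bigr => s _.
congr (_ * _); rewrite big_split_ord /= -big_split; apply: eq_bigr => i _.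
by rewrite col_mxEu col_mxEd !mxE.
Qed.

End AlternatingSum.

Section Pfaffian.
Context {R : realType} {n : nat}.
Local Notation C := R[i].
Local Notation Cn := ('rV[R]_(n + n)).

(** The matrix is diag(T, T') times the constant block matrix with rows (1, i) and (1, -i), which an
    elimination makes triangular. *)
Lemma det_complex_block (T T' : 'M[C]_n) :
  \det (col_mx (row_mx T ('i *: T)) (row_mx T' (- 'i *: T'))) =
  \det T * \det T' * (- 2 * 'i) ^+ n.
Proof.
have -> : col_mx (row_mx T ('i *: T)) (row_mx T' (- 'i *: T')) =
    block_mx T 0 0 T' *m (block_mx 1%:M 0 1%:M 1%:M *m
      block_mx 1%:M 'i%:M 0 (- 2 * 'i)%:M).
  rewrite !mulmx_block !(mul0mx, mulmx0, mul1mx, mulmx1, addr0, add0r).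
  rewrite -raddfD /= !mul_mx_scalar /block_mx.
  by rewrite (_ : 'i + - 2 * 'i = - 'i) //; ring.
rewrite !det_mulmx !det_ublock det_lblock !det1 !det_scalar.
by rewrite !mul1r.
Qed.

Lemma cstructK (v : Cn) : cstruct (cstruct v) = - v.
Proof.
by rewrite /cstruct row_mxKl row_mxKr -[in RHS](hsubmxK v) opp_row_mx.
Qed.

Lemma cstruct_delta_lshift (j : 'I_n) :
  cstruct (delta_mx 0 (lshift n j)) = delta_mx 0 (rshift n j) :> Cn.
Proof.
apply/rowP => k; rewrite /cstruct mxE; case: splitP => l kl; rewrite !mxE /=.
  have -> : k = lshift n l by apply: val_inj.
  by rewrite eq_lrshift eq_rlshift oppr0.
have -> : k = rshift n l by apply: val_inj.
by rewrite (inj_eq (@lshift_inj _ _)) (inj_eq (@rshift_inj _ _)).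
Qed.

Variable w : Cn -> Cn -> R.
Hypothesis w_linear : forall a u u' v, w (a *: u + u') v = a * w u v + w u' v.
Hypothesis w_alt : forall u v, w u v = - w v u.
Hypothesis w_cstruct : forall u v, w (cstruct u) (cstruct v) = w u v.
Hypothesis w_pos : forall u, u != 0 -> 0 < w u (cstruct u).

Local Notation e a := (delta_mx 0 (a : 'I_(n + n)) : Cn).

(* The hermitian form with imaginary part - w, C-linear on the left. *)
Definition hermitian_form (u v : Cn) : C := Complex (w u (cstruct v)) (- w u v).

Lemma form_scale a u v : w (a *: u) v = a * w u v.
Proof.
have w0 : w 0 v = 0.
  by have := w_linear (-1) 0 0 v; rewrite scaler0 addr0 mulN1r addNr.
by rewrite -[a *: u]addr0 w_linear w0 addr0.
Qed.

Lemma form_cstruct_sym u v : w u (cstruct v) = w v (cstruct u).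
Proof.
by rewrite -w_cstruct cstructK w_alt -(scaleN1r v) form_scale mulN1r opprK.
Qed.

Lemma hermitian_formDl u u' v :
  hermitian_form (u + u') v = hermitian_form u v + hermitian_form u' v.
Proof.
have wD z : w (u + u') z = w u z + w u' z.
  by rewrite -{1}[u]scale1r w_linear mul1r.
by rewrite /hermitian_form !wD opprD.
Qed.

Lemma hermitian_formZl a u v :
  hermitian_form (a *: u) v = Complex a 0 * hermitian_form u v.
Proof.
rewrite /hermitian_form !form_scale; apply/eqP; rewrite eq_complex /=.
by rewrite !mul0r subr0 addr0 mulrN !eqxx.
Qed.

Lemma hermitian_formC u v : hermitian_form v u = Num.conj (hermitian_form u v).
Proof.
apply/eqP; rewrite eq_complex /= form_cstruct_sym [w v u]w_alt !opprK.
by rewrite !eqxx.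
Qed.

Lemma hermitian_form_cstructl u v :
  hermitian_form (cstruct u) v = 'i * hermitian_form u v.
Proof.
apply/eqP; rewrite eq_complex /= w_cstruct [w (cstruct u) v]w_alt.
rewrite (form_cstruct_sym v u) opprK.
by rewrite !mul0r !mul1r sub0r add0r opprK !eqxx.
Qed.

Lemma hermitian_form_sum u v :
  hermitian_form u v = \sum_j \sum_k
    ccoord j u * Num.conj (ccoord k v) * hermitian_form (e (lshift n j)) (e (lshift n k)).
Proof.
have suml (z z' : Cn) :
    hermitian_form z z' = \sum_j ccoord j z * hermitian_form (e (lshift n j)) z'.
  have f0 : hermitian_form 0 z' = 0.
    by rewrite -(scale0r 0) hermitian_formZl mul0r.
  rewrite {1}[z]row_sum_delta big_split_ord /= hermitian_formDl.
  rewrite !(big_morph (hermitian_form^~ z') (fun a b => hermitian_formDl a b z') f0).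
  rewrite -big_split; apply: eq_bigr => j _ /=.
  rewrite !hermitian_formZl -cstruct_delta_lshift hermitian_form_cstructl mulrA.
  rewrite -mulrDl; congr (_ * _); apply/eqP; rewrite eq_complex /=.
  by rewrite !(mulr0, mulr1, subr0, addr0, add0r, mul0r) !eqxx.
rewrite suml; apply: eq_bigr => j _.
rewrite hermitian_formC suml rmorph_sum /= mulr_sumr; apply: eq_bigr => k _.
by rewrite rmorphM /= -hermitian_formC mulrA.
Qed.

Lemma hermitian_form_gram : exists2 T : 'M[C]_n, T \in unitmx &
  forall u v, hermitian_form u v = \sum_l
    (\sum_j T l j * ccoord j u) * Num.conj (\sum_k T l k * ccoord k v).
Proof.
pose H : 'M[C]_n := \matrix_(k, j) hermitian_form (e (lshift n j)) (e (lshift n k)).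
have aH : adjmx H = H.
  by apply/matrixP => k j; rewrite !mxE -hermitian_formC.
have [v vn0|T uT HT] := hermitian_posdef_gram aH.
  pose u : Cn := row_mx (\row_j complex.Re (v j 0)) (\row_j complex.Im (v j 0)).
  have uv j : ccoord j u = v j 0.
    by rewrite /ccoord row_mxEl row_mxEr !mxE; case: (v j 0).
  have -> : (adjmx v *m H *m v) 0 0 = hermitian_form u u.
    rewrite hermitian_form_sum mxE; apply: eq_bigr => j _.
    rewrite mxE mulr_suml; apply: eq_bigr => k _.
    by rewrite !mxE !uv mulrC mulrA.
  have u0 : u != 0.
    apply: contra vn0 => /eqP u0; apply/eqP/colP => j.
    by rewrite -uv u0 /ccoord !mxE.
  have wuu : w u u = 0 by apply/eqP; rewrite -eqNr -w_alt.
  by rewrite /hermitian_form wuu oppr0 ltcE /= eqxx w_pos.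
exists T => // u v; rewrite hermitian_form_sum.
under [RHS]eq_bigr do rewrite rmorph_sum mulr_suml.
rewrite [RHS]exchange_big /=; apply: eq_bigr => j _.
under [RHS]eq_bigr do rewrite mulr_sumr.
rewrite [RHS]exchange_big /=; apply: eq_bigr => k _.
have -> : hermitian_form (e (lshift n j)) (e (lshift n k)) = H k j by rewrite mxE.
rewrite HT mxE mulr_sumr; apply: eq_bigr => l _.
rewrite !mxE rmorphM /=; ring.
Qed.

(* Since symmetric parts do not contribute to the alternating sum, w may be   *)
(* replaced with 'i times its hermitian form, which is a Gram matrix of       *)
(* complex linear forms; every term of the expansion is then the determinant  *)
(* of a real matrix of a C-linear map, a nonnegative number |det|^2.          *)
Lemma wedge_power_oriented_frame_gt0 : 0 < wedge_power w oriented_frame.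
Proof.
have [T uT gramT] := hermitian_form_gram.
have half_n (k : 'I_(2 * n)) : (k./2 < n)%N.
  by rewrite ltn_half_double -mul2n ltn_ord.
pose tau (k : 'I_(2 * n)) : 'I_(n + n) :=
  if odd k then rshift n (Ordinal (half_n k)) else lshift n (Ordinal (half_n k)).
have tau_inj : injective tau.
  move=> k k'; rewrite /tau.
  case ok : (odd k); case ok' : (odd k') => /eqP.
  - rewrite (inj_eq (@rshift_inj _ _)) => /eqP[kk]; apply: val_inj => /=.
    by rewrite -(odd_double_half k) -(odd_double_half k') ok ok' kk.
  - by rewrite eq_rlshift.
  - by rewrite eq_lrshift.
  - rewrite (inj_eq (@lshift_inj _ _)) => /eqP[kk]; apply: val_inj => /=.
    by rewrite -(odd_double_half k) -(odd_double_half k') ok ok' kk.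
have val_tau k : nat_of_ord (tau k) = if odd k then (n + k./2)%N else k./2.
  by rewrite /tau; case: (odd k).
have frameE k : oriented_frame k = e (tau k) :> Cn.
  by apply/rowP => l; rewrite /oriented_frame !mxE -val_tau.
have tauL i : tau (pair_fst i) = lshift n i.
  by apply: val_inj; rewrite [LHS]val_tau /= mul2n odd_double doubleK.
have tauR i : tau (pair_snd i) = rshift n i.
  by apply: val_inj; rewrite [LHS]val_tau /= mul2n odd_double /= uphalf_double.
pose W a b := w (e a) (e b).
have -> : wedge_power w oriented_frame = (2 ^+ n)^-1 * alternating_sum (fun=> W).
  congr (_ * _); under eq_bigr do under eq_bigr do rewrite !frameE.
  rewrite (sum_perm_relabel (fun f => \prod_(i < n) W (f (pair_fst i)) (f (pair_snd i)))) //.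
    by apply: eq_bigr => s _; congr (_ * _); apply: eq_bigr => i _; rewrite tauL tauR.
  by rewrite mul2n addnn.
rewrite mulr_gt0 ?invr_gt0 ?exprn_gt0 // -ltcR.
pose Wc (a b : 'I_(n + n)) : C := real_complex R (W a b).
have -> : real_complex R (alternating_sum (fun=> W)) = alternating_sum (fun=> Wc).
  rewrite rmorph_sum; apply: eq_bigr => s _; rewrite rmorphM rmorph_sign rmorph_prod.
  by [].
pose G (a b : 'I_(n + n)) := 'i * hermitian_form (e a) (e b).
pose S (a b : 'I_(n + n)) : C := - 'i * real_complex R (w (e a) (cstruct (e b))).
have Ssym a b : S a b = S b a.
  by rewrite /S form_cstruct_sym.
have WcE a b : Wc a b = S a b + G a b.
  rewrite /S /G /Wc /W; apply/eqP; rewrite eq_complex /=.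
  by rewrite !(mul0r, mul1r, mulr0, oppr0, subr0, sub0r, addr0, add0r, mulN1r, opprK) addNr !eqxx.
pose A : 'M[C]_(n, n + n) := row_mx T ('i *: T).
pose B : 'M[C]_(n, n + n) := row_mx (map_mx Num.conj T) (- 'i *: map_mx Num.conj T).
have thetaE l (a : 'I_(n + n)) : \sum_j T l j * ccoord j (e a) = A l a.
  rewrite /A; case: (split_ordP a) => j ->.
    rewrite row_mxEl (bigD1 j) //= big1 ?addr0 => [|k kj].
      by rewrite /ccoord !mxE !eqxx eq_rlshift /= mulr1.
    rewrite /ccoord !mxE eq_rlshift (inj_eq (@lshift_inj _ _)) (negPf kj).
    by rewrite mulr0.
  rewrite row_mxEr (bigD1 j) //= big1 ?addr0 => [|k kj].
    by rewrite /ccoord !mxE !eqxx eq_lrshift /= mulrC.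
  rewrite /ccoord !mxE eq_lrshift (inj_eq (@rshift_inj _ _)) (negPf kj).
  by rewrite mulr0.
have conjA l a : Num.conj (A l a) = B l a.
  rewrite /A /B; case: (split_ordP a) => j ->.
    by rewrite !row_mxEl !mxE.
  rewrite !row_mxEr !mxE rmorphM /=; congr (_ * _).
  by apply/eqP; rewrite eq_complex /= oppr0 !eqxx.
have -> : alternating_sum (fun=> Wc) =
    \sum_(f : {ffun 'I_n -> 'I_n}) 2 ^+ n * `|\det (rowsub f T)| ^+ 2.
  have -> : (fun=> Wc) = (fun (_ : 'I_n) a b => S a b + G a b).
    by apply/funext => i; apply/funext => a; apply/funext => b; exact: WcE.
  rewrite alternating_sum_add_sym //.
  have -> : (fun=> G) = (fun (_ : 'I_n) a b => \sum_k ('i *: A) k a * B k b).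
    apply/funext => i; apply/funext => a; apply/funext => b.
    rewrite /G gramT mulr_sumr; apply: eq_bigr => k _.
    by rewrite !thetaE conjA [('i *: A) k a]mxE mulrA.
  rewrite alternating_sum_gram; apply: eq_bigr => f _.
  have -> : rowsub f ('i *: A) = row_mx (rowsub f ('i *: T)) ('i *: rowsub f ('i *: T)).
    apply/matrixP => k a; rewrite /A; case: (split_ordP a) => j ->.
      by rewrite 2![LHS]mxE !row_mxEl !mxE.
    by rewrite 2![LHS]mxE !row_mxEr !mxE.
  have -> : rowsub f B = row_mx (map_mx Num.conj (rowsub f T)) (- 'i *: map_mx Num.conj (rowsub f T)).
    apply/matrixP => k a; rewrite /B; case: (split_ordP a) => j ->.
      by rewrite [LHS]mxE !row_mxEl !mxE.
    by rewrite [LHS]mxE !row_mxEr !mxE.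
  rewrite det_complex_block.
  have -> : rowsub f ('i *: T) = 'i *: rowsub f T.
    by apply/matrixP => k a; rewrite !mxE.
  (* The factor i^n from 'i T and the factor (-2i)^n of the block determinant combine to 2^n. *)
  rewrite detZ det_map_mx normCK /= mulrC !mulrA -exprMn.
  rewrite (_ : - 2 * 'i * 'i = 2 :> C); first by [].
  by rewrite -mulrA -expr2 sqrCi mulrN1 opprK.
(* All terms are nonnegative, and the identity selection contributes 2^n |det T|^2 > 0. *)
rewrite (bigD1 [ffun i => i]) //= ltr_pwDl //; last first.
  by apply: sumr_ge0 => f _; rewrite mulr_ge0 ?exprn_ge0.
rewrite mulr_gt0 ?exprn_gt0 // normr_gt0.
rewrite (_ : rowsub _ T = T); first by rewrite -unitfE -unitmxE.
by apply/matrixP => i j; rewrite !mxE ffunE.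
Qed.

End Pfaffian.

(** * Continuity of finite sums and products, real and complex *)

Section PointwiseContinuity.
Context {R : realType} {T : topologicalType} (p : T).

Lemma continuous_sum_at (I : Type) (s : seq I) (F : I -> T -> R) :
  (forall i, {for p, continuous (F i)}) ->
  {for p, continuous (fun x => \sum_(i <- s) F i x)}.
Proof.
move=> cF; elim: s => [|i s IH].
  rewrite (_ : (fun x => _) = fun=> 0); first exact: cst_continuous.
  by apply/funext => x; rewrite big_nil.
rewrite (_ : (fun x => _) = fun x => F i x + \sum_(j <- s) F j x).
  by apply: continuousD; [exact: cF | exact: IH].
by apply/funext => x; rewrite big_cons.
Qed.

Lemma continuous_prod_at (I : Type) (s : seq I) (F : I -> T -> R) :
  (forall i, {for p, continuous (F i)}) ->
  {for p, continuous (fun x => \prod_(i <- s) F i x)}.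
Proof.
move=> cF; elim: s => [|i s IH].
  rewrite (_ : (fun x => _) = fun=> 1); first exact: cst_continuous.
  by apply/funext => x; rewrite big_nil.
rewrite (_ : (fun x => _) = fun x => F i x * \prod_(j <- s) F j x).
  by apply: continuousM; [exact: cF | exact: IH].
by apply/funext => x; rewrite big_cons.
Qed.

Definition ccontinuous_at (f : T -> R[i]) :=
  {for p, continuous (fun x => complex.Re (f x))} /\
  {for p, continuous (fun x => complex.Im (f x))}.

Lemma ccontinuous_at_cst a : ccontinuous_at (fun=> a).
Proof. by split; exact: cst_continuous. Qed.

Lemma ccontinuous_atD f g : ccontinuous_at f -> ccontinuous_at g ->
  ccontinuous_at (fun x => f x + g x).
Proof.
move=> [fR fI] [gR gI]; split.
  rewrite (_ : (fun x => _) = fun x => complex.Re (f x) + complex.Re (g x)).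
    exact: continuousD.
  by apply/funext => x; rewrite raddfD.
rewrite (_ : (fun x => _) = fun x => complex.Im (f x) + complex.Im (g x)).
  exact: continuousD.
by apply/funext => x; rewrite raddfD.
Qed.

Lemma ccontinuous_atM f g : ccontinuous_at f -> ccontinuous_at g ->
  ccontinuous_at (fun x => f x * g x).
Proof.
move=> [fR fI] [gR gI]; split.
  rewrite (_ : (fun x => _) = fun x => complex.Re (f x) * complex.Re (g x)
      - complex.Im (f x) * complex.Im (g x)).
    exact: (continuousB (continuousM fR gR) (continuousM fI gI)).
  by apply/funext => x; rewrite complexRe_mul.
rewrite (_ : (fun x => _) = fun x => complex.Re (f x) * complex.Im (g x)
    + complex.Im (f x) * complex.Re (g x)).
  exact: (continuousD (continuousM fR gI) (continuousM fI gR)).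
by apply/funext => x; rewrite complexIm_mul.
Qed.

Lemma ccontinuous_at_conj f : ccontinuous_at f ->
  ccontinuous_at (fun x => Num.conj (f x)).
Proof.
move=> [fR fI]; split.
  rewrite (_ : (fun x => _) = fun x => complex.Re (f x)) //.
  by apply/funext => x; rewrite complexRe_conj.
rewrite (_ : (fun x => _) = fun x => - complex.Im (f x)).
  exact: continuousN.
by apply/funext => x; rewrite complexIm_conj.
Qed.

Lemma ccontinuous_at_sum (I : Type) (s : seq I) (F : I -> T -> R[i]) :
  (forall i, ccontinuous_at (F i)) ->
  ccontinuous_at (fun x => \sum_(i <- s) F i x).
Proof.
move=> cF; elim: s => [|i s IH].
  rewrite (_ : (fun x => _) = fun=> 0); first exact: ccontinuous_at_cst.
  by apply/funext => x; rewrite big_nil.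
rewrite (_ : (fun x => _) = fun x => F i x + \sum_(j <- s) F j x).
  exact: ccontinuous_atD.
by apply/funext => x; rewrite big_cons.
Qed.

Lemma near_eq_ccontinuous_at (f g : T -> R[i]) :
  (\forall x \near p, f x = g x) -> ccontinuous_at f -> ccontinuous_at g.
Proof.
move=> fg; have fgp := nbhs_singleton fg.
have cont (h : R[i] -> R) : {for p, continuous (h \o f)} -> {for p, continuous (h \o g)}.
  rewrite /prop_for /continuous_at /= -fgp => ch; apply: (cvg_trans _ ch).
  by apply: near_eq_cvg; apply: filterS fg => x /= ->.
by move=> [fR fI]; split; [exact: cont fR | exact: cont fI].
Qed.

End PointwiseContinuity.

(** * Lower bounds for iterated integrals and for volumes *)

Section IteratedIntegral.
Context {R : realType}.
Local Open Scope ereal_scope.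

(* Unlike ge0_le_integral, no measurability is needed, since the integral of *)
(* a nonnegative function is defined as a supremum over simple functions.    *)
Lemma ge0_le_integralT (d : measure_display) (T : measurableType d)
    (mu : {measure set T -> \bar R}) (f g : T -> \bar R) :
  (forall x, 0 <= f x) -> (forall x, f x <= g x) ->
  \int[mu]_(x in setT) f x <= \int[mu]_(x in setT) g x.
Proof.
move=> f0 fg; rewrite !ge0_integralTE //; last first.
  by move=> x; exact: le_trans (f0 x) (fg x).
apply: ereal_sup_le => _ [h hf <-]; exists h => // x.
exact: le_trans (hf x) (fg x).
Qed.

Lemma lebesgue_iterated_ge0 k (g : 'rV[R]_k -> \bar R) :
  (forall v, 0 <= g v) -> 0 <= lebesgue_iterated g.
Proof.
elim: k g => [|k IH] g g0 /=; first exact: g0.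
by apply: integral_ge0 => x _; apply: IH => v; exact: g0.
Qed.

(** Each integration gains the length 2 delta of the interval around the corresponding coordinate of
    q. *)
Lemma lebesgue_iterated_ge_box k (g : 'rV[R]_k -> \bar R) (q : 'rV[R]_k)
    (delta eps : R) : (0 < delta)%R -> (0 <= eps)%R ->
  (forall v, 0 <= g v) ->
  (forall v : 'rV[R]_k, (forall i, `|v 0%R i - q 0%R i| < delta)%R -> eps%:E <= g v) ->
  (eps * (2 * delta) ^+ k)%:E <= lebesgue_iterated g.
Proof.
move=> d0 e0; elim: k g q => [|k IH] g q g0 gq /=.
  by rewrite expr0 mulr1; apply: gq => -[].
pose q1 : 'rV[R]_1 := @lsubmx _ 1 1 k q; pose q' : 'rV[R]_k := @rsubmx _ 1 1 k q.
pose itv := `](q1 0 0 - delta)%R, (q1 0 0 + delta)%R[%classic : set R.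
pose c := (eps * (2 * delta) ^+ k)%R.
have c0 : (0 <= c)%R by rewrite mulr_ge0 ?exprn_ge0 ?mulr_ge0 // ltW.
apply: (@le_trans _ _ (\int[@lebesgue_measure R]_(x in setT) (c * \1_itv x)%:E)).
  under eq_integral do rewrite EFinM.
  rewrite ge0_integralZl //; last first.
    by apply/measurable_EFinP; exact: measurable_indic (measurable_itv _).
  rewrite integral_indic //; last exact: measurable_itv.
  rewrite (_ : itv `&` _ = itv); last exact: setIT.
  rewrite [X in _ * X]lebesgue_measure_itv /= lte_fin.
  rewrite ltrD2l gtrN // -EFinB -EFinM lee_fin /c exprSr.
  by rewrite (_ : q1 0 0 + delta - (q1 0 0 - delta) = 2 * delta)%R ?mulrA //; ring.
apply: ge0_le_integralT => x; first by rewrite lee_fin mulr_ge0.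
rewrite indicE; have [xi|_] := boolP (x \in itv); last first.
  by rewrite mulr0; apply: lebesgue_iterated_ge0.
have xq : (`|x - q1 0 0| < delta)%R.
  by move: xi; rewrite inE /itv /= in_itv /= => /andP[? ?]; rewrite ltr_norml; apply/andP; split; lra.
rewrite mulr1; apply: (IH _ q') => // v vq; apply: gq => i.
have qE : (q : 'rV[R]_(1 + k)) = row_mx q1 q' by rewrite hsubmxK.
suff : forall l : 'I_(1 + k),
    (`|row_mx (x%:M : 'rV_1) v 0 l - (q : 'rV[R]_(1 + k)) 0 l| < delta)%R by apply.
rewrite qE => l; case: (split_ordP l) => j ->; last by rewrite !row_mxEr.
by rewrite !row_mxEl !ord1 mxE eqxx mulr1n.
Qed.

End IteratedIntegral.

Section VolumeOfOpenSets.
Context {R : realType} {n : nat} {M : compact_complex_manifold R n}.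

Lemma open_chart_image (c : chart_index M) (W : set M) : open W ->
  open (chart c @` (chart_dom c `&` W)).
Proof.
move=> oW; rewrite openE => _ [y [cy Wy] <-].
have imy : (chart c @` chart_dom c) (chart c y) by exists y.
have near_im : \forall q \near chart c y, (chart c @` chart_dom c) q.
  by apply: open_nbhs_nbhs; split=> //; exact: chart_image_open.
have near_W : \forall q \near chart c y, W (chart_inv c q).
  apply: (chart_inv_continuous imy); rewrite chartK //.
  exact: open_nbhs_nbhs.
rewrite /interior; near=> q.
have [z cz zq] : (chart c @` chart_dom c) q by near: q.
exists z => //; split=> //; rewrite -(chartK cz) zq; near: q.
exact: near_W.
Unshelve. all: by end_near. Qed.

Lemma measurable_open (U : set M) : open U -> measurable (U : set (borel M)).
Proof. exact: sub_sigma_algebra. Qed.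

Variable omega : kaehler_form M.

Lemma volume_density_gt0 c p : (chart c @` chart_dom c) p ->
  0 < volume_density omega c p.
Proof.
move=> cp; rewrite /volume_density divr_gt0 ?ltr0n ?fact_gt0 //.
apply: wedge_power_oriented_frame_gt0.
- exact: kform_linear.
- exact: kform_alternating.
- exact: kform_type11.
- exact: kform_positive.
Qed.

Lemma volume_density_continuous c p : (chart c @` chart_dom c) p ->
  {for p, continuous (volume_density omega c)}.
Proof.
move=> cp; apply: continuousM; last exact: cst_continuous.
apply: continuousM; first exact: cst_continuous.
apply: continuous_sum_at => s; apply: continuousM; first exact: cst_continuous.
apply: continuous_prod_at => i.
exact: (smooth_continuous (kform_smooth omega c _ _) cp).
Qed.

Lemma volume_open_gt0 (mu : {measure set (borel M) -> \bar R}) (U : set M) :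
  is_volume omega mu -> open U -> U !=set0 -> (0 < mu U)%E.
Proof.
move=> vol oU [x Ux]; have [c cx] := chart_cover x.
pose A : set (borel M) := chart_dom c `&` U.
have oA : open (A : set M) by apply: openI => //; exact: chart_dom_open.
have mA : measurable A by exact: measurable_open.
apply: (@lt_le_trans _ _ (mu A)); last first.
  by apply: le_measure; rewrite ?inE //; [exact: measurable_open | exact: subIsetr].
rewrite (vol c) //; last exact: subIsetl.
set O := chart c @` A; set D := volume_density omega c; set p := chart c x.
have Op : O p by exists x.
have OD q : O q -> 0 < D q.
  by move=> [y [cy _] <-]; apply: volume_density_gt0; exists y.
have Dp := OD _ Op.
(* By continuity the density exceeds half its value at p on a small box inside the chart image, and
   the box bound applies with this constant. *)
have : \forall q \near p, O q /\ D p / 2 < D q.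
  apply: filterI.
    by apply: open_nbhs_nbhs; split => //; exact: open_chart_image.
  have cD : {for p, continuous D} by apply: volume_density_continuous; exists x.
  apply: (cvgr_gt _ cD); lra.
move=> /nbhs_ballP[delta /= d0 box].
apply: (@lt_le_trans _ _ (D p / 2 * (2 * delta) ^+ (n + n))%:E).
  by rewrite lte_fin; apply: mulr_gt0; [exact: divr_gt0 | apply/exprn_gt0/mulr_gt0].
apply: (lebesgue_iterated_ge_box (q := p)) => //.
- by rewrite divr_ge0 // ltW.
- move=> v; rewrite lee_fin indicE; case: (boolP (v \in O)); rewrite ?mul0r //.
  by rewrite inE mul1r => /OD /ltW.
- move=> v vp; have [Ov Dv] : O v /\ D p / 2 < D v.
    by apply: box; split=> // i j; rewrite !ord1 /ball /= distrC.
  by rewrite lee_fin indicE mem_set // mul1r ltW.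
Qed.

End VolumeOfOpenSets.

(** * Integrals of continuous functions on the compact manifold *)

Section ContinuousIntegrands.
Context {R : realType} {n : nat} {M : compact_complex_manifold R n}.
Variable mu : {measure set (borel M) -> \bar R}.
Hypothesis mu_fin : (mu setT < +oo)%E.

Lemma continuous_integrable (f : M -> R) : continuous f ->
  mu.-integrable setT (EFin \o (f : borel M -> R)).
Proof.
move=> cf; apply: measurable_bounded_integrable => //.
  apply: (measurability _ (RGenOpens.measurableE R)).
  move=> _ [_ [a [b ->] <-]]; rewrite setTI; apply: measurable_open.
  by apply: open_comp => [y _|]; [exact: cf | exact: interval_open].
have := @continuous_compact M R f setT (continuous_subspaceT cf) (@carrier_compact _ _ M).
move=> /compact_bounded[B [_ mrt]].
by exists B; split; rewrite ?num_real // => ? ? ? ?; exact: mrt.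
Qed.

Lemma integral_continuous_eq0 (f : M -> R) :
  (forall U : set M, open U -> U !=set0 -> (0 < mu U)%E) ->
  continuous f -> (forall x, 0 <= f x) ->
  \int[mu]_(x in [set: borel M]) f x = 0 -> forall x, f x = 0.
Proof.
move=> full cf f0 int0 x; apply/eqP/negPn/negP => fx0.
have fx : 0 < f x by rewrite lt_def fx0 f0.
have fint := continuous_integrable cf.
(* If f x > 0, then f exceeds f x / 2 on this nonempty open set, whose measure is positive, so the
   integral cannot vanish. *)
pose U : set M := f @^-1` [set y | f x / 2 < y].
have oU : open U by apply: open_comp => [y _|]; [exact: cf | exact: open_gt].
have Ux : U x by rewrite /U /=; lra.
have mU := measurable_open oU.
have U0 : (0 < mu U)%E by apply: full => //; exists x.
have : (0 < \int[mu]_(x in [set: borel M]) (f x)%:E)%E.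
  apply: (@lt_le_trans _ _ (\int[mu]_(y in [set: borel M]) (f x / 2 * \1_U y)%:E)%E).
    under eq_integral do rewrite EFinM.
    rewrite ge0_integralZl //; last 2 first.
    - by apply/measurable_EFinP; exact: measurable_indic.
    - by rewrite lee_fin; lra.
    by rewrite integral_indic // setIT mule_gt0 // lte_fin; lra.
  apply: ge0_le_integralT => y; first by rewrite lee_fin mulr_ge0 //; lra.
  rewrite lee_fin indicE; case: (boolP (y \in U)); rewrite ?mulr0 ?mulr1 //.
  by rewrite inE => /ltW.
move: int0; rewrite /Rintegral => int0.
rewrite -[X in (_ < X)%E]fineK; last exact: integrable_fin_num fint.
by rewrite int0 ltxx.
Qed.

Lemma cintegralD f g : (forall x, ccontinuous_at x f) -> (forall x, ccontinuous_at x g) ->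
  cintegral mu (fun x => f x + g x) = cintegral mu f + cintegral mu g.
Proof.
move=> cf cg; rewrite /cintegral.
have fR x := (cf x).1; have fI x := (cf x).2.
have gR x := (cg x).1; have gI x := (cg x).2.
under eq_Rintegral do rewrite raddfD /=.
under [X in Complex _ X]eq_Rintegral do rewrite raddfD /=.
by rewrite !RintegralD //; exact: continuous_integrable.
Qed.

Lemma cintegralZ a f : (forall x, ccontinuous_at x f) ->
  cintegral mu (fun x => a * f x) = a * cintegral mu f.
Proof.
move=> cf; have fR x := (cf x).1; have fI x := (cf x).2; rewrite /cintegral.
under eq_Rintegral do rewrite complexRe_mul.
under [X in Complex _ X]eq_Rintegral do rewrite complexIm_mul.
have int_scale (b : R) (h : M -> R) : continuous h ->
    mu.-integrable setT (EFin \o (fun x : borel M => b * h x)).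
  move=> ch; apply: continuous_integrable => x.
  by apply: continuousM; [exact: cst_continuous | exact: ch].
rewrite RintegralB ?RintegralD ?RintegralZl //; try exact: int_scale;
  try exact: continuous_integrable.
by case: a.
Qed.

Lemma cintegral_sum (I : Type) (s : seq I) (F : I -> M -> R[i]) :
  (forall i x, ccontinuous_at x (F i)) ->
  cintegral mu (fun x => \sum_(i <- s) F i x) = \sum_(i <- s) cintegral mu (F i).
Proof.
move=> cF; elim: s => [|i s IH].
  rewrite big_nil; under eq_fun do rewrite big_nil.
  by rewrite /cintegral /Rintegral /= !integral0.
rewrite big_cons -IH -cintegralD //; last by move=> x; exact: ccontinuous_at_sum.
by congr (cintegral mu _); apply/funext => x; rewrite big_cons.
Qed.

End ContinuousIntegrands.

(** * Bases of sections and the pulled back metric *)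

Section Bundle.
Context {R : realType} {n : nat} {M : compact_complex_manifold R n} {r : nat}.
Variable E : holomorphic_bundle M r.
Local Notation C := R[i].

Lemma triv_inj a x : triv_dom a x -> injective (@triv _ _ _ _ E a x).
Proof. by move=> /(triv_bij (h := E)) /bij_inj. Qed.

Lemma triv_surj a x (w : 'cV[C]_r) : triv_dom a x ->
  exists v, @triv _ _ _ _ E a x v = w.
Proof. by move=> /(triv_bij (h := E))[g _ gK]; exists (g w). Qed.

Definition section_mx {N : nat} (a : triv_index E) (s : 'I_N -> forall x, E x)
    (x : M) : 'M[C]_(r, N) :=
  \matrix_(i, j) triv a x (s j x) i 0.

Lemma triv_section_sum {N} a (s : 'I_N -> forall x, E x) x (c : 'cV[C]_N) :
  triv a x (\sum_j c j 0 *: s j x) = section_mx a s x *m c.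
Proof.
rewrite linear_sum; apply/colP => i; rewrite mxE summxE.
by apply: eq_bigr => j _; rewrite linearZ !mxE mulrC.
Qed.

Lemma triv_section {N} a (s : 'I_N -> forall x, E x) x j :
  triv a x (s j x) = col j (section_mx a s x).
Proof. by apply/colP => i; rewrite !mxE. Qed.

Section Basis.
Context {N : nat} {s : 'I_N -> forall x, E x}.
Hypothesis s_basis : is_basis_H0 s.

Lemma H0_basis_free (c : 'I_N -> C) : (forall x, \sum_j c j *: s j x = 0) ->
  forall j, c j = 0.
Proof.
move=> c0 j; have [d [_ dU]] := s_basis.2 _ (s_basis.1 j).
(* Both e and e' = c + e are coordinates of s j, so uniqueness of coordinates forces c = 0. *)
pose e : 'rV[C]_N := delta_mx 0 j; pose e' : 'rV[C]_N := \row_k (c k + e 0 k).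
have sE x : \sum_k e 0 k *: s k x = s j x.
  rewrite (bigD1 j) //= big1 => [|k kj]; first by rewrite mxE !eqxx scale1r addr0.
  by rewrite mxE (negPf kj) andbF scale0r.
have de : d = e by apply: dU => x; rewrite sE.
have de' : d = e'.
  apply: dU => x; under eq_bigr do rewrite mxE scalerDl.
  by rewrite big_split /= c0 add0r sE.
have ce : c j + e 0 j = e 0 j by rewrite -[in RHS]de de' [in RHS]mxE.
by apply: (addIr (e 0 j)); rewrite add0r.
Qed.

Hypothesis gg : globally_generated E.

Lemma basis_span x (v : E x) : exists c : 'cV[C]_N, v = \sum_j c j 0 *: s j x.
Proof.
have [t tH tx] := gg v; have [c [tc _]] := s_basis.2 _ tH.
by exists c^T; rewrite -tx tc; apply: eq_bigr => j _; rewrite mxE.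
Qed.

(** If u S = 0, global generation writes u^H as S c, whence u u^H = u S c = 0. *)
Lemma section_mx_free a x : triv_dom a x -> row_free (section_mx a s x).
Proof.
move=> ax; apply: inj_row_free => u uS; apply: mul_adjmx_eq0.
have [v vE] := triv_surj (adjmx u) ax; have [c cE] := basis_span v.
by rewrite -vE cE triv_section_sum mulmxA uS mul0mx.
Qed.

End Basis.

Lemma basis_change {N N'} (s : 'I_N -> forall x, E x) (t : 'I_N' -> forall x, E x) :
  is_basis_H0 s -> is_basis_H0 t -> exists (A : 'M[C]_(N, N')) (B : 'M[C]_(N', N)),
  [/\ A *m B = 1%:M, B *m A = 1%:M &
      forall k x, t k x = \sum_j A j k *: s j x].
Proof.
have coef p p' (u : 'I_p -> forall x, E x) (w : 'I_p' -> forall x, E x) :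
    is_basis_H0 u -> is_basis_H0 w ->
    {A : 'M[C]_(p, p') | forall k x, w k x = \sum_j A j k *: u j x}.
  move=> bu bw; have ex k := cid (bu.2 _ (bw.1 k)).
  exists (\matrix_(j, k) (sval (ex k)) 0 j) => k x.
  by rewrite (svalP (ex k)).1; apply: eq_bigr => j _; rewrite mxE.
have inv p p' (u : 'I_p -> forall x, E x) (w : 'I_p' -> forall x, E x)
    (A : 'M[C]_(p, p')) (B : 'M[C]_(p', p)) : is_basis_H0 u ->
    (forall k x, w k x = \sum_j A j k *: u j x) ->
    (forall k x, u k x = \sum_j B j k *: w j x) -> A *m B = 1%:M.
  move=> bu wA uB; apply/matrixP => i j; apply/eqP; rewrite -subr_eq0; apply/eqP.
  apply: (H0_basis_free bu (c := fun i => (A *m B) i j - (1%:M : 'M[C]_p) i j)) => x.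
  under eq_bigr do rewrite scalerBl.
  rewrite sumrB; apply/eqP; rewrite subr_eq0; apply/eqP.
  transitivity (u j x).
    rewrite uB; under [RHS]eq_bigr do rewrite wA scaler_sumr.
    rewrite exchange_big /=; apply: eq_bigr => k _.
    by rewrite mxE scaler_suml; apply: eq_bigr => l _; rewrite scalerA mulrC.
  rewrite (bigD1 j) //= big1 => [|k kj]; first by rewrite mxE eqxx scale1r addr0.
  by rewrite mxE (negPf kj) scale0r.
move=> bs bt; have [A tA] := coef _ _ _ _ bs bt; have [B sB] := coef _ _ _ _ bt bs.
by exists A, B; split=> //; [exact: inv bs tA sB | exact: inv bt sB tA].
Qed.

Lemma basis_size {N N'} (s : 'I_N -> forall x, E x) (t : 'I_N' -> forall x, E x) :
  is_basis_H0 s -> is_basis_H0 t -> N = N'.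
Proof.
move=> bs bt; have [A [B [AB BA _]]] := basis_change bs bt.
apply/eqP; rewrite eqn_leq; apply/andP; split.
  by rewrite -(mxrank1 C N) -AB (leq_trans (mxrankM_maxl _ _)) // rank_leq_col.
by rewrite -(mxrank1 C N') -BA (leq_trans (mxrankM_maxl _ _)) // rank_leq_col.
Qed.

Lemma linear_functional a x (xi : 'rV[C]_r) :
  exists f : {linear E x -> C^o}, forall v, f v = (xi *m triv a x v) 0 0.
Proof.
pose f (v : E x) : C^o := (xi *m triv a x v) 0 0.
have lf : linear f.
  by move=> k u v; rewrite /f linearP mulmxDr -scalemxAr !mxE.
pose F : {linear E x -> C^o} := HB.pack f (GRing.isLinear.Build _ _ _ _ f lf).
by exists F.
Qed.

Section KodairaMetric.
Context {N : nat} (s : 'I_N -> forall x, E x).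

Lemma flat_metricE (v w : 'cV[C]_N) :
  flat_metric v w = \sum_k Num.conj (w k 0) * v k 0.
Proof. by rewrite /flat_metric mxE; apply: eq_bigr => k _; rewrite !mxE. Qed.

Lemma flat_metric_dual x (xi : {linear E x -> C^o}) (p : 'cV[C]_N) :
  flat_metric (dual_evaluation s xi) p = xi (\sum_k Num.conj (p k 0) *: s k x).
Proof.
rewrite flat_metricE linear_sum; apply: eq_bigr => k _.
by rewrite linearZ mxE.
Qed.

(** Such a p represents v by [flat_metric_dual]. Two representatives differ by a vector that is both
    in the Kodaira subspace and orthogonal to it, hence zero. *)
Lemma riesz_vectorE x (v : E x) (p : 'cV[C]_N) : kodaira s x p ->
  v = \sum_k Num.conj (p k 0) *: s k x -> riesz_vector s v = p.
Proof.
move=> kp vE; apply: xget_unique.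
  by split=> // xi; rewrite flat_metric_dual vE.
move=> q [kq qE].
have [zeta _ zq] := kq; have [pi _ pp] := kp.
have same (xi : {linear E x -> C^o}) : flat_metric (dual_evaluation s xi) (q - p) = 0.
  rewrite /flat_metric adjmxB mulmxBl mxE [X in _ + X]mxE -!/(flat_metric _ _).
  by rewrite -qE flat_metric_dual -vE subrr.
apply/eqP; rewrite -subr_eq0; apply/eqP; apply: mxtrace_adj_mul_eq0.
rewrite /mxtrace big_ord1 -[LHS]/(flat_metric (q - p) (q - p)).
have := same zeta; have := same pi; rewrite zq pp /flat_metric => h1 h2.
by rewrite mulmxBr mxE h2 [X in _ + X]mxE h1 subr0.
Qed.

Lemma kodaira_metricE x (v w : E x) (p q : 'cV[C]_N) :
  kodaira s x p -> v = \sum_k Num.conj (p k 0) *: s k x ->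
  kodaira s x q -> w = \sum_k Num.conj (q k 0) *: s k x ->
  kodaira_metric s v w = flat_metric q p.
Proof.
by move=> kp vE kq wE; rewrite /kodaira_metric (riesz_vectorE kp vE) (riesz_vectorE kq wE).
Qed.

Hypothesis s_basis : is_basis_H0 s.
Hypothesis gg : globally_generated E.

(** The solution c of S c = v of least norm; its conjugate is the Riesz vector of v. *)
Let min_preimage a x (v : E x) : 'cV[C]_N :=
  adjmx (section_mx a s x) *m
    (invmx (section_mx a s x *m adjmx (section_mx a s x)) *m triv a x v).

Let min_preimage_kodaira a x (v : E x) :
  kodaira s x (map_mx Num.conj (min_preimage a v)).
Proof.
rewrite /min_preimage; move: (invmx _ *m triv a x v) => z.
have [f fE] := linear_functional a x (adjmx z).
exists f => //; apply/colP => k; rewrite !mxE fE mxE rmorph_sum.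
by apply: eq_bigr => i _; rewrite !mxE rmorphM /= conjCK mulrC.
Qed.

Let min_preimage_sum a x (v : E x) : triv_dom a x ->
  v = \sum_k Num.conj (map_mx Num.conj (min_preimage a v) k 0) *: s k x.
Proof.
move=> ax; apply: (triv_inj ax); under eq_bigr do rewrite mxE conjCK.
rewrite triv_section_sum /min_preimage mulmxA mulKVmx //.
by apply: gram_unitmx; exact: section_mx_free.
Qed.

Lemma kodaira_riesz x (v : E x) : exists2 p, kodaira s x p &
  v = \sum_k Num.conj (p k 0) *: s k x.
Proof.
have [a ax] := triv_cover E x.
by exists (map_mx Num.conj (min_preimage a v)); [exact: min_preimage_kodaira | exact: min_preimage_sum].
Qed.

Lemma kodaira_metric_triv a x (v w : E x) : triv_dom a x ->
  kodaira_metric s v w = (adjmx (triv a x w) *m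
    invmx (section_mx a s x *m adjmx (section_mx a s x)) *m triv a x v) 0 0.
Proof.
move=> ax; rewrite (kodaira_metricE (min_preimage_kodaira a v) (min_preimage_sum v ax)
  (min_preimage_kodaira a w) (min_preimage_sum w ax)).
have flat_conj (p q : 'cV[C]_N) :
    flat_metric (map_mx Num.conj q) (map_mx Num.conj p) = (adjmx q *m p) 0 0.
  by rewrite flat_metricE mxE; apply: eq_bigr => k _; rewrite !mxE conjCK mulrC.
rewrite flat_conj; congr (fun_of_matrix _ 0 0); rewrite /min_preimage.
set S := section_mx a s x; set K := invmx (S *m adjmx S).
have uG : S *m adjmx S \in unitmx by apply: gram_unitmx; exact: section_mx_free.
have aK : adjmx K = K by rewrite /K adjmx_inv adjmxM adjmxK.
rewrite !adjmxM adjmxK aK -!mulmxA; congr (_ *m (_ *m _)).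
by rewrite (mulmxA S) mulKVmx.
Qed.

Lemma kodaira_metric_section a x j k : triv_dom a x ->
  kodaira_metric s (s j x) (s k x) = row_proj (section_mx a s x) k j.
Proof.
move=> ax; rewrite (kodaira_metric_triv _ _ ax) !triv_section.
set S := section_mx a s x; set K := invmx _.
have -> : adjmx (col k S) = row k (adjmx S).
  by apply/rowP => i; rewrite !mxE.
rewrite /row_proj -/K -row_mul; move: (adjmx S *m K) => Q.
by rewrite !mxE; apply: eq_bigr => i _; rewrite !mxE.
Qed.

End KodairaMetric.

Lemma csmooth_on_ccontinuous_at (W : set M) (f : M -> C) x : open W -> W x ->
  csmooth_on W f -> ccontinuous_at x f.
Proof.
move=> oW Wx sf; have [c cx] := chart_cover x.
have [sR sI] := sf c.
have im : (chart c @` (chart_dom c `&` W)) (chart c x) by exists x.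
have near_dom : \forall y \near x, chart_dom c y.
  by apply: open_nbhs_nbhs; split=> //; exact: chart_dom_open.
have cont (h : C -> R) :
    smooth (chart c @` (chart_dom c `&` W)) (fun p => h (f (chart_inv c p))) ->
    {for x, continuous (fun y => h (f y))}.
  move=> sh; have ch := smooth_continuous sh im.
  have : {for x, continuous ((fun p => h (f (chart_inv c p))) \o chart c)}.
    by apply: continuous_comp => //; exact: chart_continuous.
  rewrite /prop_for /continuous_at /= chartK // => cc; apply: (cvg_trans _ cc).
  by apply: near_eq_cvg; apply: filterS near_dom => y cy /=; rewrite chartK.
by split; exact: cont.
Qed.

Lemma H0_ccontinuous_at (a : triv_index E) (s : forall x, E x) x i : H0 s ->
  triv_dom a x -> ccontinuous_at x (fun y => triv a y (s y) i 0).
Proof.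
move=> Hs ax; apply: (csmooth_on_ccontinuous_at (triv_dom_open a) ax) => c.
by have [] := Hs a i c.
Qed.

Lemma hermitian_metric_ccontinuous (h : forall x, E x -> E x -> C) (s t : forall x, E x) x :
  is_hermitian_metric h -> H0 s -> H0 t -> ccontinuous_at x (fun y => h y (s y) (t y)).
Proof.
move=> [_ _ _ hH] Hs Ht; have [a ax] := triv_cover E x.
have [H [hE sH]] := hH a.
pose g y := \sum_j (\sum_i Num.conj (triv a y (t y) i 0) * H y i j) * triv a y (s y) j 0.
apply: (@near_eq_ccontinuous_at _ _ _ g).
  apply: filterS (open_nbhs_nbhs (conj (triv_dom_open a) ax)) => y ay.
  rewrite hE // mxE; apply: eq_bigr => j _; rewrite mxE; congr (_ * _).
  by apply: eq_bigr => i _; rewrite !mxE.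
apply: ccontinuous_at_sum => j; apply: ccontinuous_atM; last exact: H0_ccontinuous_at.
apply: ccontinuous_at_sum => i; apply: ccontinuous_atM.
  by apply: ccontinuous_at_conj; exact: H0_ccontinuous_at.
exact: (csmooth_on_ccontinuous_at (triv_dom_open a) ax).
Qed.

End Bundle.

(** * Automorphisms induced by matrices commuting with the projections *)

Section MatrixIsometry.
Context {R : realType} {r N : nat}.
Local Notation C := R[i].
Variables (S : 'M[C]_(r, N)) (D : 'M[C]_N).
Hypothesis fS : row_free S.
Hypothesis uD : D \in unitmx.
Hypothesis PD : row_proj S *m D = D *m row_proj S.

(** The solution F of F S = S D, obtained by applying the right inverse S^H (S S^H)^-1 of S; it
    exists when D commutes with the projection. *)
Definition induced_endo : 'M[C]_r :=
  S *m D *m adjmx S *m invmx (S *m adjmx S).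

Lemma induced_endoE : induced_endo *m S = S *m D.
Proof.
have -> : induced_endo *m S = S *m D *m row_proj S.
  by rewrite /induced_endo /row_proj !mulmxA.
by rewrite -mulmxA -PD mulmxA mul_row_proj.
Qed.

End MatrixIsometry.

(** Let G = S S^H and let H be induced by D^-1, so that H is inverse to F. As T = D^-1 D^-1 and H S
    = S D^-1, one gets S T S^H = H G H^H; now invert. *)
Lemma induced_endo_isometry {R : realType} {r N} (S : 'M[R[i]]_(r, N)) (T D : 'M[R[i]]_N) :
  row_free S -> D \in unitmx -> adjmx D = D -> D *m T *m D = 1%:M ->
  row_proj S *m D = D *m row_proj S ->
  adjmx (induced_endo S D) *m invmx (S *m adjmx S) *m induced_endo S D =
  invmx (S *m T *m adjmx S).
Proof.
move=> fS uD aD DTD PD.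
have PV : row_proj S *m invmx D = invmx D *m row_proj S.
  by rewrite -[LHS](mulKmx uD) (mulmxA D) -PD mulmxK.
have FS := induced_endoE fS PD; have HS := induced_endoE fS PV.
have uG := gram_unitmx fS.
have [G GE] : {G | G = S *m adjmx S} by exists (S *m adjmx S).
rewrite -GE in uG *.
move: (induced_endo S D) (induced_endo S (invmx D)) FS HS => F H FS HS.
have FH : F *m H = 1%:M.
  by apply: (row_free_inj fS); rewrite -mulmxA HS mulmxA FS mul1mx mulmxK.
have HF := mulmx1C FH.
have TE : T = invmx D *m invmx D.
  by rewrite -[LHS](mulKmx uD) -[X in _ *m X](mulmxK uD) DTD mul1mx.
have XE : S *m T *m adjmx S = H *m G *m adjmx H.
  have -> : H *m G *m adjmx H = H *m S *m adjmx (H *m S) by rewrite adjmxM GE !mulmxA.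
  by rewrite HS adjmxM adjmx_inv aD TE !mulmxA.
have XY : (S *m T *m adjmx S) *m (adjmx F *m invmx G *m F) = 1%:M.
  rewrite XE -!mulmxA (mulmxA (adjmx H)) -adjmxM FH adjmx1 mul1mx.
  by rewrite (mulmxA G) mulmxV // mul1mx HF.
have [uX _] := mulmx1_unit XY.
by rewrite -[LHS](mulKmx uX) XY mulmx1.
Qed.

Section HolomorphicMatrices.
Context {R : realType} {n : nat}.
Local Notation Cn := ('rV[R]_(n + n)).
Variables (U : set Cn) (oU : open U).

Lemma holomorphic_sum (I : Type) (s : seq I) (F : I -> Cn -> R[i]) :
  (forall i, holomorphic U (F i)) -> holomorphic U (fun p => \sum_(i <- s) F i p).
Proof.
move=> hF; elim: s => [|i s IH].
  rewrite (_ : (fun p => _) = fun=> 0); first exact: holomorphic_cst.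
  by apply/funext => p; rewrite big_nil.
rewrite (_ : (fun p => _) = fun p => F i p + \sum_(j <- s) F j p).
  exact: holomorphicD.
by apply/funext => p; rewrite big_cons.
Qed.

Lemma holomorphic_prod (I : Type) (s : seq I) (F : I -> Cn -> R[i]) :
  (forall i, holomorphic U (F i)) -> holomorphic U (fun p => \prod_(i <- s) F i p).
Proof.
move=> hF; elim: s => [|i s IH].
  rewrite (_ : (fun p => _) = fun=> 1); first exact: holomorphic_cst.
  by apply/funext => p; rewrite big_nil.
rewrite (_ : (fun p => _) = fun p => F i p * \prod_(j <- s) F j p).
  exact: holomorphicM.
by apply/funext => p; rewrite big_cons.
Qed.

Lemma holomorphic_det k (A : Cn -> 'M[R[i]]_k) :
  (forall i j, holomorphic U (fun p => A p i j)) ->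
  holomorphic U (fun p => \det (A p)).
Proof.
move=> hA; apply: holomorphic_sum => s.
by apply: holomorphicM => //; [exact: holomorphic_cst | exact: holomorphic_prod].
Qed.

Lemma open_holomorphic_neq0 (f : Cn -> R[i]) : holomorphic U f ->
  open (U `&` [set p | f p != 0]).
Proof.
move=> [[sR sI] _]; rewrite openE => p [Up fp]; rewrite /interior.
pose N2 q := complex.Re (f q) * complex.Re (f q) + complex.Im (f q) * complex.Im (f q).
have N2E q : (N2 q != 0) = (f q != 0).
  rewrite /N2 -!expr2; case: (f q) => a b; rewrite eq_complex /=.
  by rewrite paddr_eq0 ?sqr_ge0 // !sqrf_eq0.
have cN : {for p, continuous N2}.
  have cR := smooth_continuous sR Up; have cI := smooth_continuous sI Up.
  exact: (continuousD (continuousM cR cR) (continuousM cI cI)).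
have near_ne : \forall q \near p, N2 q != 0.
  by apply: (cvgr_neq0 _ cN); rewrite N2E.
apply: filterS2 near_ne (open_nbhs_nbhs (conj oU Up)) => q.
by rewrite N2E.
Qed.

Lemma holomorphic_mulmx_inv k l (A : Cn -> 'M[R[i]]_(l, k)) (B : Cn -> 'M[R[i]]_k) :
  (forall i j, holomorphic U (fun p => A p i j)) ->
  (forall i j, holomorphic U (fun p => B p i j)) ->
  (forall p, U p -> \det (B p) != 0) ->
  forall i j, holomorphic U (fun p => (A p *m invmx (B p)) i j).
Proof.
move=> hA hB B0 i j.
apply: (eq_holomorphic (f := fun p => \sum_m A p i m * ((\det (B p))^-1 *
    ((-1) ^+ (j + m) * \det (row' j (col' m (B p))))))) => // [p Up|].
  rewrite mxE; apply: eq_bigr => m _; congr (_ * _).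
  by rewrite /invmx unitmxE unitfE B0 // !mxE.
apply: holomorphic_sum => m; apply: holomorphicM => //.
apply: holomorphicM => //.
  by apply: holomorphicV => //; exact: holomorphic_det.
apply: holomorphicM => //; first exact: holomorphic_cst.
by apply: holomorphic_det => i' j'; under eq_fun do rewrite !mxE; exact: hB.
Qed.

End HolomorphicMatrices.

Section Endomorphisms.
Context {R : realType} {n : nat} {M : compact_complex_manifold R n} {r N : nat}.
Variable E : holomorphic_bundle M r.
Local Notation C := R[i].
Variable s : 'I_N -> forall x, E x.
Hypothesis s_basis : is_basis_H0 s.
Hypothesis gg : globally_generated E.

(** The defining formula involves S^H and is not visibly holomorphic. But F S = S D, so wherever the
    columns J of S form an invertible minor S_J, F is (S D)_J S_J^-1, which is holomorphic. *)
Lemma holomorphic_induced_endo (D : 'M[C]_N) a :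
  (forall x, triv_dom a x ->
     row_proj (section_mx a s x) *m D = D *m row_proj (section_mx a s x)) ->
  forall i j, holomorphic_on (triv_dom a) (fun x => induced_endo (section_mx a s x) D i j).
Proof.
move=> PD i j c; set U := chart c @` _.
have oU : open U by apply: open_chart_image; exact: triv_dom_open.
have hS k l : holomorphic U (fun p => section_mx a s (chart_inv c p) k l).
  by under eq_fun do rewrite mxE; exact: (s_basis.1 l a k c).
apply: holomorphic_local => p [x [cx ax] <-].
have fS := section_mx_free s_basis gg ax.
have fullS : row_full (section_mx a s x)^T by rewrite /row_full mxrank_tr.
pose J := fullrankfun fullS.
have hSJ k l : holomorphic U (fun p => colsub J (section_mx a s (chart_inv c p)) k l).
  by under eq_fun do rewrite mxE; exact: hS.
have hdet := holomorphic_det oU hSJ.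
exists (U `&` [set q | \det (colsub J (section_mx a s (chart_inv c q))) != 0]).
  split; first by exists x.
  have := fullrowsub_unit fullS; rewrite -trmx_mxsub unitmx_tr unitmxE unitfE.
  by rewrite /= chartK.
set V := (X in holomorphic X _).
have VU : V `<=` U by exact: subIsetl.
apply: (eq_holomorphic (f := fun q => (colsub J (section_mx a s (chart_inv c q) *m D)
    *m invmx (colsub J (section_mx a s (chart_inv c q)))) i j)).
- exact: open_holomorphic_neq0.
- move=> q [[y [cy ay] <-]]; rewrite /= chartK // => dJ; congr (fun_of_matrix _ i j).
  have uJ : colsub J (section_mx a s y) \in unitmx by rewrite unitmxE unitfE.
  have fSy := section_mx_free s_basis gg ay.
  rewrite -(induced_endoE fSy (PD _ ay)).
  have -> : colsub J (induced_endo (section_mx a s y) D *m section_mx a s y) =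
      induced_endo (section_mx a s y) D *m colsub J (section_mx a s y).
    by move: (induced_endo _ _) => Q; apply/matrixP => k l; rewrite !mxE;
      apply: eq_bigr => m _; rewrite !mxE.
  by rewrite mulmxK.
apply: holomorphic_mulmx_inv => //.
- exact: open_holomorphic_neq0.
- move=> k l; apply: (holomorphic_sub VU).
  rewrite (_ : (fun q => _) = fun q => \sum_m section_mx a s (chart_inv c q) k m * D m (J l)).
    apply: holomorphic_sum => // m; apply: holomorphicM => //; exact: holomorphic_cst.
  by apply/funext => q; rewrite mxE mxE.
- by move=> k l; apply: (holomorphic_sub VU).
- by move=> q [].
Qed.

Lemma exists_endo (D : 'M[C]_N) :
  (forall a x, triv_dom a x ->
     row_proj (section_mx a s x) *m D = D *m row_proj (section_mx a s x)) ->
  exists F : forall x, {linear E x -> E x},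
    forall x j, F x (s j x) = \sum_k D k j *: s k x.
Proof.
move=> PD.
have endo_at x : exists F : {linear E x -> E x},
    forall j, F (s j x) = \sum_k D k j *: s k x.
  have [a ax] := triv_cover E x.
  have [g gK Kg] := triv_bij ax.
  (* The chosen trivialization does not matter: the values on the sections s j, which span the
     fiber, determine the map. *)
  pose f v := g (induced_endo (section_mx a s x) D *m triv a x v).
  have lf : linear f.
    move=> k u v; apply: (triv_inj ax); rewrite [RHS]linearP /f !Kg.
    by rewrite [triv a x (_ + _)]linearP mulmxDr -scalemxAr.
  pose F : {linear E x -> E x} := HB.pack f (GRing.isLinear.Build _ _ _ _ f lf).
  exists F => j; apply: (triv_inj ax); rewrite /= /f Kg triv_section.
  have -> : \sum_k D k j *: s k x = \sum_k (col j D) k 0 *: s k x.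
    by apply: eq_bigr => k _; rewrite mxE.
  have fS := section_mx_free s_basis gg ax.
  by rewrite triv_section_sum !colE !mulmxA induced_endoE //; exact: PD.
exists (fun x => sval (cid (endo_at x))) => x.
exact: (svalP (cid (endo_at x))).
Qed.

Lemma triv_endo (D : 'M[C]_N) (F : forall x, {linear E x -> E x}) a x v :
  (forall x j, F x (s j x) = \sum_k D k j *: s k x) ->
  row_proj (section_mx a s x) *m D = D *m row_proj (section_mx a s x) ->
  triv_dom a x ->
  triv a x (F x v) = induced_endo (section_mx a s x) D *m triv a x v.
Proof.
move=> FD PD ax; have fS := section_mx_free s_basis gg ax.
have [c ->] := basis_span s_basis gg v.
rewrite triv_section_sum mulmxA induced_endoE // -mulmxA -triv_section_sum.
congr (triv a x _); rewrite linear_sum.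
under eq_bigr do rewrite linearZ FD /= scaler_sumr.
rewrite exchange_big /=; apply: eq_bigr => k _.
rewrite mxE scaler_suml; apply: eq_bigr => j _.
by rewrite scalerA mulrC.
Qed.

Lemma endo_cancel (D D' : 'M[C]_N) (F F' : forall x, {linear E x -> E x}) :
  (forall x j, F x (s j x) = \sum_k D k j *: s k x) ->
  (forall x j, F' x (s j x) = \sum_k D' k j *: s k x) ->
  D *m D' = 1%:M -> forall x, cancel (F' x) (F x).
Proof.
move=> FD FD' DD' x v; have [c ->] := basis_span s_basis gg v.
rewrite !linear_sum; apply: eq_bigr => j _; rewrite !linearZ; congr (_ *: _).
rewrite FD' linear_sum; under eq_bigr do rewrite linearZ FD /= scaler_sumr.
rewrite exchange_big (bigD1 j) //= [X in _ + X]big1 ?addr0 => [|k kj].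
  under eq_bigr do rewrite scalerA mulrC.
  rewrite -scaler_suml; move/matrixP/(_ j j): DD'; rewrite !mxE eqxx => ->.
  by rewrite scale1r.
under eq_bigr do rewrite scalerA mulrC.
rewrite -scaler_suml; move/matrixP/(_ k j): DD'; rewrite !mxE (negPf kj) => ->.
by rewrite scale0r.
Qed.

End Endomorphisms.

(** * Uniqueness and the slope inequality *)

Section BalancedMetrics.
Context {R : realType} {n : nat} {M : compact_complex_manifold R n} {r : nat}.
Variables (E : holomorphic_bundle M r) (mu : {measure set (borel M) -> \bar R}).
Local Notation C := R[i].
Implicit Types h : forall x, E x -> E x -> C.

Definition total_volume : C := Complex (fine (mu [set: borel M])) 0.

Definition gram {N : nat} h (s : 'I_N -> forall x, E x) (x : M) : 'M[C]_N :=
  \matrix_(k, j) h x (s j x) (s k x).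

Lemma cintegral_ge0 (f : M -> C) : (forall x, 0 <= f x) -> 0 <= cintegral mu f.
Proof.
move=> f0; rewrite lecE /=; apply/andP; split.
  have -> : (fun x : borel M => complex.Im (f x)) = fun=> 0.
    by apply/funext => x; exact: ger0_Im.
  by rewrite /Rintegral integral0.
by apply: Rintegral_ge0 => x _; have := f0 x; rewrite lecE => /andP[].
Qed.

Lemma cintegral_cst (a : C) : cintegral mu (fun=> a) = a * total_volume.
Proof.
rewrite /cintegral !Rintegral_cst //; apply/eqP.
by rewrite eq_complex complexRe_mul complexIm_mul /= !mulr0 subr0 add0r !eqxx.
Qed.

Section Basis.
Context {N : nat} {s : 'I_N -> forall x, E x} {h : forall x, E x -> E x -> C}.
Arguments h : clear implicits.
Hypothesis s_basis : is_basis_H0 s.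
Hypothesis gg : globally_generated E.
Hypothesis h_metric : is_hermitian_metric h.
Hypothesis hs : forall x (v w : E x), h x v w = kodaira_metric s v w.
Hypothesis hL2 : forall j k, L2_product mu h (s j) (s k) = r%:R / N%:R * (j == k)%:R.

Lemma gram_row_proj a x : triv_dom a x -> gram h s x = row_proj (section_mx a s x).
Proof.
move=> ax; apply/matrixP => k j; rewrite mxE hs.
exact: kodaira_metric_section.
Qed.

Lemma rank_le_basis : (r <= N)%N.
Proof.
have [a ax] := triv_cover E (point : M).
have /eqP <- := section_mx_free s_basis gg ax.
exact: rank_leq_col.
Qed.

Hypothesis r_gt0 : (0 < r)%N.

(** The normalization of the L2 product forces this. For zero or infinite mass, [fine] gives 0,
    whose inverse is 0, so all L2 products would vanish; yet the diagonal ones equal r / N, which is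
    nonzero. *)
Lemma balanced_total_volume : 0 < total_volume /\ (mu setT < +oo)%E.
Proof.
have N_gt0 := leq_trans r_gt0 rank_le_basis.
have V0 : total_volume != 0.
  apply/eqP => V0; have := hL2 (Ordinal N_gt0) (Ordinal N_gt0).
  rewrite /L2_product -/total_volume V0 invr0 mul0r eqxx mulr1 => /esym/eqP.
  by rewrite mulf_eq0 invr_eq0 !pnatr_eq0 !eqn0Ngt r_gt0 N_gt0.
split.
  rewrite lt_def V0 lecE /= eqxx /=; exact: fine_ge0.
rewrite ltey; apply: contra V0 => /eqP muoo.
by rewrite /total_volume muoo.
Qed.

Lemma cintegral_tr_gram (X : 'M[C]_N) :
  cintegral mu (fun x => \tr (gram h s x *m X)) =
  total_volume * (r%:R / N%:R) * \tr X.
Proof.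
have [V0 mu_fin] := balanced_total_volume.
have cg k j x : ccontinuous_at x (fun y => h y (s j y) (s k y)).
  by apply: hermitian_metric_ccontinuous => //; exact: s_basis.1.
have int_gram j k : cintegral mu (fun x => h x (s j x) (s k x)) =
    total_volume * (r%:R / N%:R) * (j == k)%:R.
  rewrite -mulrA -hL2 /L2_product -/total_volume mulrA divff ?mul1r //.
  by rewrite gt_eqF.
have -> : (fun x => \tr (gram h s x *m X)) =
    fun x => \sum_k \sum_j X j k * h x (s j x) (s k x).
  apply/funext => x; apply: eq_bigr => k _; rewrite mxE.
  by apply: eq_bigr => j _; rewrite mxE mulrC.
have cX k x : ccontinuous_at x (fun y => \sum_j X j k * h y (s j y) (s k y)).
  by apply: ccontinuous_at_sum => j; apply: ccontinuous_atM => //; exact: ccontinuous_at_cst.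
rewrite cintegral_sum // mulr_sumr; apply: eq_bigr => k _.
rewrite cintegral_sum //; last first.
  by move=> j x; apply: ccontinuous_atM => //; exact: ccontinuous_at_cst.
rewrite (bigD1 k) //= big1 ?addr0 => [|j jk].
  by rewrite cintegralZ // int_gram eqxx mulr1 mulrC.
by rewrite cintegralZ // int_gram (negPf jk) !mulr0.
Qed.

Lemma ccontinuous_tr_gram (X : 'M[C]_N) x :
  ccontinuous_at x (fun y => \tr (gram h s y *m X)).
Proof.
apply: ccontinuous_at_sum => k.
rewrite (_ : (fun y => _) = fun y => \sum_j h y (s j y) (s k y) * X j k); last first.
  by apply/funext => y; rewrite mxE; apply: eq_bigr => j _; rewrite mxE.
apply: ccontinuous_at_sum => j; apply: ccontinuous_atM; last exact: ccontinuous_at_cst.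
by apply: hermitian_metric_ccontinuous => //; exact: s_basis.1.
Qed.

(* The sections u_k take values in a subbundle of rank q.                    *)
Lemma balanced_slope (p q : nat) (u : 'I_p -> forall x, E x) :
  (forall k, H0 (u k)) ->
  (forall c : 'I_p -> C, (forall x, \sum_k c k *: u k x = 0) -> forall k, c k = 0) ->
  (forall x, exists a (L : 'M[C]_(r, q)) (L' : 'M[C]_(q, r)) (Y : 'M[C]_(q, p)),
     [/\ triv_dom a x, L' *m L = 1%:M & section_mx a u x = L *m Y]) ->
  (p * r <= q * N)%N.
Proof.
move=> Hu uF usub.
have [V0 mu_fin] := balanced_total_volume.
have N_gt0 := leq_trans r_gt0 rank_le_basis.
have ex k := cid (s_basis.2 _ (Hu k)).
pose U : 'M[C]_(N, p) := \matrix_(j, k) (sval (ex k)) 0 j.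
have uE k x : u k x = \sum_j U j k *: s j x.
  by rewrite (svalP (ex k)).1; apply: eq_bigr => j _; rewrite mxE.
have [{}U {}uE] : {U' : 'M[C]_(N, p) | forall k x, u k x = \sum_j U' j k *: s j x}.
  by exists U.
have SU a x : section_mx a u x = section_mx a s x *m U.
  apply/matrixP => i k; rewrite !mxE uE linear_sum summxE.
  by apply: eq_bigr => j _; rewrite linearZ !mxE mulrC.
(* Linear independence of the u k is injectivity of their coefficient matrix U. *)
have fU : row_free (adjmx U).
  apply: inj_row_free => v vU.
  have Uv : U *m adjmx v = 0.
    by rewrite -[U]adjmxK -adjmxM vU; apply/matrixP => i j; rewrite !mxE rmorph0.
  have := uF (fun k => Num.conj (v 0 k)) _.
  have H : forall x, \sum_k Num.conj (v 0 k) *: u k x = 0.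
    move=> x; have [a ax] := triv_cover E x.
    apply: (triv_inj ax); rewrite linear0.
    have -> : \sum_k Num.conj (v 0 k) *: u k x = \sum_k (adjmx v) k 0 *: u k x.
      by apply: eq_bigr => k _; rewrite !mxE.
    by rewrite triv_section_sum SU -mulmxA Uv mulmx0.
  move=> /(_ H) v0; apply/rowP => k; rewrite mxE.
  by apply/eqP; rewrite -conjC_eq0; apply/eqP; exact: v0.
(* The projection onto the column space of U has trace p, so this integral equals V (q - p r / N),
   with V the total volume. *)
have : 0 <= cintegral mu (fun x => q%:R + (-1) * \tr (gram h s x *m row_proj (adjmx U))).
  apply: cintegral_ge0 => x; have [a [L [L' [Y [ax LL uLY]]]]] := usub x.
  rewrite mulN1r subr_ge0 (gram_row_proj ax).
  apply: mxtrace_row_proj_sub LL fU _; last by rewrite -SU; exact: uLY.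
  exact: section_mx_free.
rewrite cintegralD //; last 2 first.
- by move=> x; exact: ccontinuous_at_cst.
- by move=> x; apply: ccontinuous_atM; [exact: ccontinuous_at_cst | exact: ccontinuous_tr_gram].
rewrite cintegralZ //; last exact: ccontinuous_tr_gram.
rewrite cintegral_cst cintegral_tr_gram mxtrace_row_proj // mulN1r subr_ge0.
rewrite -mulrA [q%:R * _]mulrC ler_pM2l // mulrAC ler_pdivrMr ?ltr0n //.
by rewrite -!natrM ler_nat mulnC.
Qed.

End Basis.

Lemma balanced_unique h h' : globally_generated E -> (0 < r)%N ->
  (forall U : set M, open U -> U !=set0 -> (0 < mu U)%E) ->
  is_balanced mu h -> is_balanced mu h' ->
  exists2 F : (forall x, {linear E x -> E x}), is_automorphism F &
    forall x (v w : E x), h' x v w = h x (F x v) (F x w).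
Proof.
move=> gg r_gt0 full [hM [N [s [bs hs hL2]]]] [hM' [N' [s' [bs' hs' hL2']]]].
have [V0 mu_fin] := balanced_total_volume bs gg hL2 r_gt0.
have eN := basis_size bs bs'; subst N'.
have [A [B [AB BA s'E]]] := basis_change bs bs'.
have [uA _] := mulmx1_unit AB.
pose T := A *m adjmx A.
have SA a x : section_mx a s' x = section_mx a s x *m A.
  apply/matrixP => i k; rewrite !mxE s'E linear_sum summxE.
  by apply: eq_bigr => j _; rewrite linearZ !mxE mulrC.
pose gap x := \tr (gram h' s' x *m (adjmx A *m A)) + (-1) * \tr (gram h s x *m T).
have cgap x : ccontinuous_at x gap.
  apply: ccontinuous_atD; first exact: ccontinuous_tr_gram.
  by apply: ccontinuous_atM; [exact: ccontinuous_at_cst | exact: ccontinuous_tr_gram].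
have gapE a x : triv_dom a x -> exists Z : 'M[C]_N, gap x = \tr (adjmx Z *m Z) /\
    (Z = 0 -> row_proj (section_mx a s x) *m T = T *m row_proj (section_mx a s x)).
  move=> ax; have [Z [ZE Z0]] := row_proj_gap (section_mx_free bs gg ax) uA.
  exists Z; split=> //.
  by rewrite -ZE /gap (gram_row_proj bs' gg hs' ax) (gram_row_proj bs gg hs ax) SA mulN1r.
have gap_ge0 x : 0 <= gap x.
  have [a ax] := triv_cover E x; have [Z [-> _]] := gapE _ _ ax.
  exact: mxtrace_adj_mul_ge0.
(* Both bases have the same r and N, so the integral is a multiple of tr(A^H A) - tr(A A^H) = 0. *)
have int_gap : cintegral mu gap = 0.
  rewrite cintegralD //; last 2 first.
  - by move=> x; exact: ccontinuous_tr_gram.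
  - by move=> x; apply: ccontinuous_atM; [exact: ccontinuous_at_cst | exact: ccontinuous_tr_gram].
  rewrite cintegralZ //; last by move=> x; exact: ccontinuous_tr_gram.
  rewrite (cintegral_tr_gram bs' gg hM' hL2' r_gt0) (cintegral_tr_gram bs gg hM hL2 r_gt0).
  by rewrite /T mxtrace_mulC mulN1r subrr.
have gap0 x : gap x = 0.
  have Re0 : complex.Re (gap x) = 0.
    apply: (integral_continuous_eq0 mu_fin full (f := fun y => complex.Re (gap y))).
    - by move=> y; exact: (cgap y).1.
    - by move=> y; have := gap_ge0 y; rewrite lecE => /andP[].
    - by have := congr1 (@complex.Re R) int_gap.
  by apply/eqP; rewrite eq_complex /= Re0 (ger0_Im (gap_ge0 x)) !eqxx.
have PT a x : triv_dom a x ->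
    row_proj (section_mx a s x) *m T = T *m row_proj (section_mx a s x).
  move=> ax; have [Z [ZE]] := gapE _ _ ax; apply.
  by apply: mxtrace_adj_mul_eq0; rewrite -ZE gap0.
have [D [aD uD DTD DP]] := gram_inv_sqrt uA.
have PD a x (ax : triv_dom a x) := DP _ (PT a x ax).
have PV a x : triv_dom a x ->
    row_proj (section_mx a s x) *m invmx D = invmx D *m row_proj (section_mx a s x).
  (* The inverse of D also commutes with the projections, and induces the inverse automorphism. *)
  by move=> ax; rewrite -[LHS](mulKmx uD) (mulmxA D) -PD // mulmxK.
have [F FE] := exists_endo bs gg PD; have [G GE] := exists_endo bs gg PV.
exists F; first split.
- move=> x; exists (G x); [exact: (endo_cancel bs gg GE FE (mulVmx uD)) |
    exact: (endo_cancel bs gg FE GE (mulmxV uD))].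
- move=> a; exists (fun x => induced_endo (section_mx a s x) D); split.
    by move=> x ax v; apply: triv_endo => //; exact: PD.
  by apply: holomorphic_induced_endo => // x; exact: PD.
- move=> x v w; have [a ax] := triv_cover E x.
  have fS := section_mx_free bs gg ax.
  (* In the frame, h' has matrix (S T S^H)^-1 and h has matrix (S S^H)^-1; [induced_endo_isometry]
     relates them. *)
  rewrite hs hs' (kodaira_metric_triv bs' gg _ _ ax) (kodaira_metric_triv bs gg _ _ ax).
  rewrite !(triv_endo bs gg _ FE (PD _ _ ax) ax) SA adjmxM.
  rewrite [adjmx (induced_endo _ _ *m _)]adjmxM.
  have := induced_endo_isometry fS uD aD DTD (PD _ _ ax).
  rewrite /T !mulmxA => <-.
  by rewrite !mulmxA.
Qed.

End BalancedMetrics.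

(** * Direct sums *)

Lemma sum_tagnat (V : nmodType) (m : nat) (N : 'I_m -> nat) (G : 'I_(\sum_j N j) -> V) :
  \sum_k G k = \sum_j \sum_(i < N j) G (tagnat.Rank j i).
Proof.
rewrite (reindex tagnat.rank) /=; last exact: tagnat.rank_bij_on.
by rewrite sig_big_dep /=; apply: eq_bigr => p _; rewrite tagnat.rankE.
Qed.

Lemma mxcol_Rank (T : Type) (m c : nat) (N : 'I_m -> nat)
    (B : forall j, 'M[T]_(N j, c)) j i l :
  (\mxcol_j B j) (tagnat.Rank j i) l = B j i l.
Proof. by rewrite -[in RHS](mxcolK B j) [RHS]mxE. Qed.

Section DirectSumSections.
Context {R : realType} {n : nat} {M : compact_complex_manifold R n}.
Context {m : nat} {r : 'I_m -> nat} (E : forall j, holomorphic_bundle M (r j)).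
Local Notation C := R[i].
Local Notation D := (direct_sum E).

Definition summand {x : M} {j : 'I_m} (v : E j x) : D x :=
  @eqtype.dfwith _ (fun l => E l x) (fun l => 0) j v.

Lemma summand_in x j (v : E j x) : summand v j = v.
Proof. exact: dfwith_in. Qed.

Lemma summand_out x j (v : E j x) l : j != l -> summand v l = 0.
Proof. exact: dfwith_out. Qed.

Lemma dsum_sum_component x (I : Type) (s : seq I) (F : I -> D x) j :
  (\sum_(i <- s) F i) j = \sum_(i <- s) F i j.
Proof.
elim: s => [|i s IH]; first by rewrite !big_nil.
by rewrite !big_cons -IH.
Qed.

Lemma dsum_H0 (t : forall x, D x) : (forall j, H0 (fun x => t x j)) -> H0 t.
Proof.
move=> Ht a i.
rewrite (_ : (fun x => _) = fun x => triv (a (tagnat.sig1 i)) x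
    (t x (tagnat.sig1 i)) (tagnat.sig2 i) 0); last by apply/funext => x; rewrite mxE.
by apply: holomorphic_on_sub (Ht _ _ _) => x; apply.
Qed.

Lemma summand_H0 j (s : forall x, E j x) : H0 s -> H0 (fun x => summand (s x)).
Proof.
move=> Hs; apply: dsum_H0 => l b i; have [e|ne] := eqVneq j l; last first.
  rewrite (_ : (fun x => _) = fun=> 0); first exact: holomorphic_on0.
  by apply/funext => x; rewrite summand_out // linear0 mxE.
subst l; rewrite (_ : (fun x => _) = fun x => triv b x (s x) i 0); first exact: Hs.
by apply/funext => x; rewrite summand_in.
Qed.

(** A trivialization of the sum lives only on the intersection of the domains of its components.
    Near each point, b is therefore completed by trivializations of the other summands chosen around
    that point. *)
Lemma H0_component (t : forall x, D x) j : H0 t -> H0 (fun x => t x j).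
Proof.
move=> Ht b i c; apply: holomorphic_local => p [x [cx bx] <-].
pose a : triv_index D := @eqtype.dfwith _ (fun l => triv_index (E l))
    (fun k => sval (cid (triv_cover (E k) x))) j b.
have ax : triv_dom a x.
  move=> k; rewrite /a; have [e|ne] := eqVneq j k.
    by subst k; rewrite dfwith_in.
  by rewrite dfwith_out //; exact: (svalP (cid (triv_cover (E k) x))).
exists (chart c @` (chart_dom c `&` triv_dom a)); first by exists x.
have := Ht a (tagnat.Rank j i) c.
rewrite (_ : (fun q => _) = fun q => triv b (chart_inv c q) (t (chart_inv c q) j) i 0) //.
by apply/funext => q; rewrite /= /dsum_triv_fun mxcol_Rank /a dfwith_in.
Qed.

Lemma dsum_globally_generated :
  (forall j, globally_generated (E j)) -> globally_generated D.
Proof.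
move=> gg x v.
have ex j : {s : forall y, E j y | H0 s /\ s x = v j}.
  by apply: cid; have [s Hs sx] := gg j x (v j); exists s.
exists (fun y j => sval (ex j) y).
  by apply: dsum_H0 => j; exact: (svalP (ex j)).1.
by apply: functional_extensionality_dep => j; exact: (svalP (ex j)).2.
Qed.

Section UnionBasis.
Context {N : 'I_m -> nat} (s : forall j, 'I_(N j) -> forall x, E j x).
Arguments s : clear implicits.

Definition union_basis (k : 'I_(\sum_j N j)) (x : M) : D x :=
  summand (s _ (tagged (tagnat.sig k)) x).

Lemma union_basis_Rank j i : union_basis (tagnat.Rank j i) = fun x => summand (s j i x).
Proof. by apply: functional_extensionality_dep => x; rewrite /union_basis tagnat.rankK. Qed.

Lemma union_basis_sum (c : 'I_(\sum_j N j) -> C) x j :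
  (\sum_k c k *: union_basis k x) j = \sum_i c (tagnat.Rank j i) *: s j i x.
Proof.
rewrite dsum_sum_component sum_tagnat (bigD1 j) //= [X in _ + X]big1 ?addr0.
  by apply: eq_bigr => i _; rewrite union_basis_Rank -[in RHS](summand_in (s j i x)).
move=> l lj; rewrite big1 // => i _; rewrite union_basis_Rank.
by rewrite -[LHS]/(_ *: summand (s l i x) j) summand_out // scaler0.
Qed.

Lemma union_basisP : (forall j, is_basis_H0 (s j)) -> is_basis_H0 union_basis.
Proof.
move=> bs; split=> [k|t Ht].
  rewrite -(tagnat.sig2K k) union_basis_Rank; apply: summand_H0.
  exact: (bs _).1.
have ex j := cid ((bs j).2 _ (H0_component (j := j) Ht)).
pose c j : 'rV[C]_(N j) := sval (ex j).
have cRank j i : (\mxrow_j c j) 0 (tagnat.Rank j i) = c j 0 i.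
  by rewrite -[in RHS](mxrowK c j) [RHS]mxE.
exists (\mxrow_j c j); split=> [x|d dP].
  apply: functional_extensionality_dep => j; rewrite union_basis_sum.
  by rewrite (svalP (ex j)).1; apply: eq_bigr => i _; rewrite cRank.
rewrite -[RHS](submxrowK d); apply/eq_mxrowP => j.
apply: (svalP (ex j)).2 => x; rewrite dP union_basis_sum.
by apply: eq_bigr => i _; rewrite mxE.
Qed.

(** Functionals on the summands add up to one on the sum, whose values on the union basis are the
    stacked values. *)
Lemma union_kodaira x (p : forall j, 'cV[C]_(N j)) :
  (forall j, kodaira (s j) x (p j)) -> kodaira union_basis x (\mxcol_j p j).
Proof.
move=> kp; have ex j : {xi : {linear E j x -> C^o} | dual_evaluation (s j) xi = p j}.
  by apply: cid; have [xi _ xip] := kp j; exists xi.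
pose f (v : D x) : C^o := \sum_j sval (ex j) (v j).
have lf : linear f.
  move=> a u v; rewrite /f scaler_sumr -big_split; apply: eq_bigr => j _.
  exact: (linearP (sval (ex j)) a (u j) (v j)).
pose F : {linear D x -> C^o} := HB.pack f (GRing.isLinear.Build _ _ _ _ f lf).
exists F => //; apply/colP => k; rewrite -(tagnat.sig2K k).
move: (tagnat.sig1 k) (tagnat.sig2 k) => j i; rewrite mxcol_Rank mxE union_basis_Rank /= /f.
rewrite (bigD1 j) //= big1 ?addr0 => [|l lj]; last by rewrite summand_out ?linear0 // eq_sym.
by rewrite summand_in; case: (ex j) => xi /= <-; rewrite mxE.
Qed.

(** Riesz vectors for the union basis are obtained by stacking those of the summands, and the flat
    product is additive over blocks. *)
Lemma union_kodaira_metric x (v w : D x) :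
  (forall j, is_basis_H0 (s j)) -> (forall j, globally_generated (E j)) ->
  kodaira_metric union_basis v w = \sum_j kodaira_metric (s j) (v j) (w j).
Proof.
move=> bs gg.
have ex (u : D x) j : {p : 'cV[C]_(N j) | kodaira (s j) x p /\
    u j = \sum_k Num.conj (p k 0) *: s j k x}.
  by apply: cid; have [p kp uE] := kodaira_riesz (bs j) (gg j) (u j); exists p.
have sum_ex (u : D x) :
    u = \sum_k Num.conj ((\mxcol_j sval (ex u j)) k 0) *: union_basis k x.
  apply: functional_extensionality_dep => j; rewrite union_basis_sum.
  by rewrite {1}(svalP (ex u j)).2; apply: eq_bigr => i _; rewrite mxcol_Rank.
rewrite (kodaira_metricE (union_kodaira (fun j => (svalP (ex v j)).1)) (sum_ex v)
  (union_kodaira (fun j => (svalP (ex w j)).1)) (sum_ex w)).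
rewrite flat_metricE sum_tagnat; apply: eq_bigr => j _.
rewrite (kodaira_metricE (svalP (ex v j)).1 (svalP (ex v j)).2
  (svalP (ex w j)).1 (svalP (ex w j)).2) flat_metricE.
by apply: eq_bigr => i _; rewrite !mxcol_Rank.
Qed.

End UnionBasis.

Section DirectSumMetric.
Variable h : forall j x, E j x -> E j x -> C.
Arguments h : clear implicits.

Definition dsum_metric (x : M) (v w : D x) : C := \sum_j h j x (v j) (w j).

Lemma dsum_metric_hermitian : (forall j, is_hermitian_metric (h j)) ->
  is_hermitian_metric dsum_metric.
Proof.
move=> hM; split.
- move=> x a u v w; rewrite /dsum_metric mulr_sumr -big_split.
  by apply: eq_bigr => j _; have [-> _ _ _] := hM j.
- move=> x v w; rewrite /dsum_metric rmorph_sum; apply: eq_bigr => j _.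
  by have [_ -> _ _] := hM j.
- move=> x v v0.
  have h_ge0 j : 0 <= h j x (v j) (v j).
    have [-> | vj] := eqVneq (v j) 0; last by have [_ _ /(_ _ _ vj)/ltW] := hM j.
    have [lin _ _ _] := hM j.
    by have := lin x (-1) 0 0 0; rewrite scaler0 addr0 mulN1r addNr => ->.
  have [j vj] : exists j, v j != 0.
    apply: contrapT => nv; move/eqP: v0; apply.
    apply: functional_extensionality_dep => j; apply/eqP/negPn/negP => vj.
    by apply: nv; exists j.
  rewrite /dsum_metric (bigD1 j) //= ltr_pwDl //; last exact: sumr_ge0.
  by have [_ _ /(_ _ _ vj)] := hM j.
- move=> a.
  have ex j : {H : M -> 'M[C]_(r j) | (forall x, triv_dom (a j) x -> forall v w : E j x,
        h j x v w = (adjmx (triv (a j) x w) *m H x *m triv (a j) x v) 0 0) /\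
      forall i k, csmooth_on (triv_dom (a j)) (fun x => H x i k)}.
    by apply: cid; have [_ _ _ /(_ (a j))] := hM j.
  exists (fun x => \mxdiag_j sval (ex j) x); split.
    move=> x ax v w; rewrite /dsum_metric /= /dsum_triv_fun.
    rewrite -mulmxA mul_mxdiag_mxcol mxE sum_tagnat; apply: eq_bigr => j _.
    rewrite ((svalP (ex j)).1 x (ax j)) -mulmxA mxE; apply: eq_bigr => i _.
    rewrite mxcol_Rank; congr (_ * _).
    by rewrite [RHS]mxE [in RHS]mxE mxcol_Rank !mxE.
  move=> i k; have [[l [u [v e]]]|e] := mxdiag_entry (R := R) i k; last first.
    rewrite (_ : (fun x => _) = fun=> 0); first by move=> c; exact: csmooth_cst.
    by apply/funext => x; rewrite e.
  rewrite (_ : (fun x => _) = fun x => sval (ex l) x u v); last first.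
    by apply/funext => x; rewrite (e (fun j => sval (ex j) x)).
  move=> c; have [sR sI] := (svalP (ex l)).2 u v c.
  have sub : chart c @` (chart_dom c `&` triv_dom (a : triv_index D)) `<=`
      chart c @` (chart_dom c `&` triv_dom (a l)).
    by apply: image_subset => x [cx ax].
  by split=> d; apply: differentiability_class_sub sub _; [exact: sR | exact: sI].
Qed.

End DirectSumMetric.

Lemma summand_triv_sub j {p} (u : 'I_p -> forall x, E j x) x :
  exists a (L : 'M[C]_(\sum_j r j, r j)) (L' : 'M[C]_(r j, \sum_j r j)) (Y : 'M[C]_(r j, p)),
    [/\ @triv_dom _ _ _ _ D a x, L' *m L = 1%:M &
      section_mx a (fun i x => summand (u i x)) x = L *m Y].
Proof.
have [a ax] := triv_cover D x.
(* In a product trivialization the inclusion of the j-th summand is the constant block inclusion,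
   with its transpose as left inverse. *)
pose L : 'M[C]_(\sum_j r j, r j) := \matrix_(k, i) (k == tagnat.Rank j i)%:R.
have RankE i i' : (tagnat.Rank j i == tagnat.Rank j i' :> 'I_(\sum_j r j)) = (i == i').
  by rewrite -val_eqE tagnat.eq_Rank eqxx.
exists a, L, L^T, (section_mx (a j) u x); split=> //.
  apply/matrixP => i i'; rewrite mxE (bigD1 (tagnat.Rank j i)) //= [X in _ + X]big1 ?addr0.
    by rewrite !mxE eqxx mul1r RankE.
  by move=> k ki; rewrite !mxE (negPf ki) mul0r.
apply/matrixP => k i; rewrite -(tagnat.sig2K k).
move: (tagnat.sig1 k) (tagnat.sig2 k) => l i'.
rewrite mxE /= /dsum_triv_fun mxcol_Rank mxE; have [e|ne] := eqVneq j l.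
  subst l; rewrite summand_in (bigD1 i') //= [X in _ + X]big1 ?addr0.
    by rewrite !mxE eqxx mul1r.
  by move=> q qi; rewrite !mxE RankE eq_sym (negPf qi) mul0r.
rewrite summand_out // linear0 mxE big1 // => q _.
by rewrite !mxE -val_eqE tagnat.eq_Rank eq_sym (negPf ne) mul0r.
Qed.

End DirectSumSections.
Arguments summand {R n M m r} E {x j} v.
Arguments summand_in {R n M m r} E {x j} v.

(** * Balanced metrics on the direct sum *)

Lemma basis_rank_gt0 (R : realType) (n : nat) (M : compact_complex_manifold R n)
    (r N : nat) (E : holomorphic_bundle M r) (s : 'I_N -> forall x, E x) :
  is_basis_H0 s -> (0 < N)%N -> (0 < r)%N.
Proof.
move=> bs N0; rewrite lt0n; apply/negP => /eqP r0.
have s0 x : \sum_j (fun=> 1) j *: s j x = 0.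
  have [a ax] := triv_cover E x; apply: (triv_inj ax); apply/colP => i.
  by exfalso; case: i => i; rewrite r0.
by have /eqP := H0_basis_free bs s0 (Ordinal N0); rewrite oner_eq0.
Qed.

Lemma ratio_eq (F : numFieldType) (a b c d : nat) : (0 < b)%N -> (0 < d)%N ->
  (a%:R / b%:R = c%:R / d%:R :> F) <-> (a * d = c * b)%N.
Proof.
move=> b0 d0; split.
  move/eqP; rewrite eqr_div ?pnatr_eq0 -?lt0n // -!natrM eqr_nat => /eqP ->.
  by [].
move=> e; apply/eqP; rewrite eqr_div ?pnatr_eq0 -?lt0n // -!natrM eqr_nat.
by rewrite e.
Qed.

Theorem theorem3 (R : realType) (n : nat) (M : compact_complex_manifold R n)
    (omega : kaehler_form M)
    (vol : {measure set (borel M) -> \bar R}) (vol_omega : is_volume omega vol)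
    (m : nat) (m_gt0 : (0 < m)%N) (r N : 'I_m -> nat)
    (E : forall j : 'I_m, holomorphic_bundle M (r j))
    (E_very_ample : forall j, very_ample (E j))
    (E_dim_H0 : forall j, dim_H0 (E j) (N j))
    (N_gt0 : forall j, (0 < N j)%N)
    (E_balanced : forall j, exists h, @is_balanced R n M (r j) (E j) vol h) :
  admits_unique_balanced (direct_sum E) vol <->
  forall j k : 'I_m, (r j)%:R / (N j)%:R = (r k)%:R / (N k)%:R :> rat.
Proof.
have full (U : set M) : open U -> U !=set0 -> (0 < vol U)%E.
  exact: volume_open_gt0 vol_omega.
have gg j : globally_generated (E j) := (E_very_ample j).1.
have ggD : globally_generated (direct_sum E) by exact: dsum_globally_generated.
have data j : {hs : (forall x, E j x -> E j x -> R[i]) * ('I_(N j) -> forall x, E j x) |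
    [/\ is_hermitian_metric hs.1, is_basis_H0 hs.2,
      forall x (v w : E j x), hs.1 x v w = kodaira_metric hs.2 v w &
      forall i k, L2_product vol hs.1 (hs.2 i) (hs.2 k) =
        (r j)%:R / (N j)%:R * (i == k)%:R]}.
  apply: cid; have [h [hM [N' [s [bs hs hL2]]]]] := E_balanced j.
  (* The balanced basis comes with its own size N', which is identified with N j. *)
  have [s' bs'] := E_dim_H0 j; have e := basis_size bs bs'.
  by move: s bs hs hL2; rewrite e => s bs hs hL2; exists (h, s).
pose h j := (sval (data j)).1; pose s j := (sval (data j)).2.
have hM j : is_hermitian_metric (h j) by have [] := svalP (data j).
have bs j : is_basis_H0 (s j) by have [] := svalP (data j).
have hs j : forall x (v w : E j x), h j x v w = kodaira_metric (s j) v w.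
  by have [] := svalP (data j).
have hL2 j : forall i k, L2_product vol (h j) (s j i) (s j k) =
    (r j)%:R / (N j)%:R * (i == k)%:R by have [] := svalP (data j).
have r_gt0 j : (0 < r j)%N := basis_rank_gt0 (bs j) (N_gt0 j).
pose j0 : 'I_m := Ordinal m_gt0.
have sumr_gt0 : (0 < \sum_j r j)%N by rewrite (bigD1 j0) //= ltn_addr.
have sumN_gt0 : (0 < \sum_j N j)%N by rewrite (bigD1 j0) //= ltn_addr.
have bD := union_basisP bs.
split.
- move=> [[hD [hDM [N' [t [bt ht tL2]]]]] _].
  have eN := basis_size bt bD; subst N'.
  (* The slope inequality for the subbundle E j and its N j independent sections. *)
  have slope j : (N j * \sum_l r l <= r j * \sum_l N l)%N.
    apply: (balanced_slope bt ggD hDM ht tL2 sumr_gt0 (u := fun i x => summand E (s j i x))).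
    - by move=> i; apply: summand_H0; exact: (bs j).1.
    - move=> c c0; apply: (H0_basis_free (bs j)) => x.
      have cj : (\sum_i c i *: summand E (s j i x)) j = 0 by rewrite c0.
      rewrite -[RHS]cj dsum_sum_component; apply: eq_bigr => i _.
      by rewrite -[in LHS](summand_in E (s j i x)).
    - by move=> x; exact: (@summand_triv_sub _ _ _ _ _ E j _ (s j) x).
  have slope_eq j : (N j * \sum_l r l = r j * \sum_l N l)%N.
    apply/eqP; rewrite eqn_leq slope /=.
    have tot : (\sum_j N j * \sum_l r l = \sum_j r j * \sum_l N l)%N.
      by rewrite -!big_distrl /= mulnC.
    (* Both sides of the slope inequalities have the same total over j, so a strict one is
       impossible. *)
    rewrite leqNgt; apply/negP => lt_j; move: tot; apply/eqP.
    rewrite neq_ltn; apply/orP; left.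
    rewrite (bigD1 j) //= [ltnRHS](bigD1 j) //= -addSn leq_add //.
    by apply: leq_sum => l _; exact: slope.
  have ratio j : (r j)%:R / (N j)%:R = (\sum_l r l)%:R / (\sum_l N l)%:R :> rat.
    by apply/ratio_eq => //; rewrite -slope_eq mulnC.
  by move=> j k; rewrite !ratio.
- move=> ratio; split; last first.
    by move=> g g'; exact: balanced_unique.
  exists (dsum_metric h); split; first exact: dsum_metric_hermitian.
  exists (\sum_j N j)%N, (union_basis s); split=> //.
    move=> x v w; rewrite union_kodaira_metric //; apply: eq_bigr => j _.
    exact: hs.
  (* Equal fractions equal their mediant, so each block already carries the constant required of the
     sum. *)
  have ratioD j : (r j)%:R / (N j)%:R = (\sum_l r l)%:R / (\sum_l N l)%:R :> R[i].
    apply/ratio_eq => //; rewrite !big_distrl big_distrr /=; apply: eq_bigr => l _.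
    by have /ratio_eq := ratio j l; apply.
  move=> k k'; rewrite -(tagnat.sig2K k) -(tagnat.sig2K k').
  move: (tagnat.sig1 k) (tagnat.sig2 k) (tagnat.sig1 k') (tagnat.sig2 k') => j i l i'.
  rewrite !union_basis_Rank -val_eqE tagnat.eq_Rank.
  have h0l q x (w : E q x) : h q x 0 w = 0.
    have [lin _ _ _] := hM q.
    by have := lin x (-1) 0 0 w; rewrite scaler0 addr0 mulN1r addNr.
  have h0r q x (w : E q x) : h q x w 0 = 0.
    by have [_ sym _ _] := hM q; rewrite sym h0l rmorph0.
  have [e|ne] := eqVneq j l; last first.
    (* Sections of different summands are pointwise orthogonal. *)
    rewrite mulr0 /L2_product (_ : (fun x => _) = fun=> 0).
      by rewrite cintegral_cst mul0r mulr0.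
    apply/funext => x; apply: big1 => q _; have [e|nq] := eqVneq j q.
      by subst q; rewrite [summand E (s l _ _) _]summand_out ?h0r // eq_sym.
    by rewrite summand_out ?h0l.
  subst l; rewrite -(ratioD j) -hL2 /L2_product; congr (_ * cintegral vol _).
  apply/funext => x; rewrite /dsum_metric (bigD1 j) //= big1 ?addr0.
    by rewrite !summand_in.
  by move=> q qj; rewrite summand_out ?h0l // eq_sym.
Qed.
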